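(* Let $\psi\colon\mathcal{P}(\mathbb{Z}_+)\to\mathcal{P}(\mathbb{Z}_+)$ be measurable, write $\mu^q:=\psi(q)$, and let $(\eta(t))_{t\ge0}$ be the $\psi$-nonlinear process. Assume that $\mathbb{E}(\eta(0))=r\in[0,1)$, that $\mathbb{E}(e^{\lambda\eta(0)})<+\infty$ for some $\lambda>0$, that the Mean Condition and the Thinning Condition hold, and that there exists a unique $\bar\pi\in\{\pi_{\mu^q}\colon q\in\mathcal{P}(\mathbb{Z}_+),\ m_{\mu^q}<1\}$ whose mean is $m_{\bar\pi}=r$. Then $\eta(t)$ converges weakly (in distribution) to $\bar\pi$ as $t\to+\infty$.
   Context: $\mathbb{Z}_+$ is the set of non-negative integers; $\mathcal{P}(\mathbb{Z}_+)$ is the set of probability measures on $\mathbb{Z}_+$ with the total variation distance $\Vert p-q\Vert:=\sup_{A}(p(A)-q(A))$. For $\mu\in\mathcal{P}(\mathbb{Z}_+)$, $m_\mu$ denotes its mean. $\psi$-nonlinear process: the discrete-time random process $(\eta(t))_{t\ge0}$ with values in $\mathbb{Z}_+$ such that, if $q$ is the distribution of $\eta(t)$, then $\eta(t+1)=\eta(t)-\mathbf{1}(\eta(t)>0)+B^q$, where $B^q$ is a $\mathbb{Z}_+$-valued random variable with distribution $\psi(q)=\mu^q$, generated independently of everything else at each time step. G$_\mu$/D/1 queue: for $\mu\in\mathcal{P}(\mathbb{Z}_+)$, the Markov chain $(\zeta(t))_{t\ge0}$ on $\mathbb{Z}_+$ with $\zeta(t+1)=\zeta(t)-\mathbf{1}(\zeta(t)>0)+B$,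 where $B$ has distribution $\mu$ and is generated independently of everything else at each time step. For $m_\mu<1$ this chain has a unique invariant probability measure, denoted $\pi_\mu$. Mean Condition: $\mathbb{E}(B^q)=1-q(\{0\})$ for any $q\in\mathcal{P}(\mathbb{Z}_+)$, and $\psi(q)$ depends on $q$ only through $q(\{0\})$. Thinning Condition: for any $q\in\mathcal{P}(\mathbb{Z}_+)$ and any $p\in[0,1]$, if $B^q$ has distribution $\mu^q$ and $X_1,X_2,\dots$ are i.i.d. Bernoulli random variables of parameter $p$, independent of $B^q$, then $\sum_{k=1}^{B^q}X_k$ (with the empty sum equal to $0$) has distribution $\mu^{q'}$ for some $q'\in\mathcal{P}(\mathbb{Z}_+)$. *)

(* Defs.v *)
From HB Require Import structures.
From mathcomp Require Import all_boot all_order all_algebra.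
From mathcomp Require Import finmap.
From mathcomp Require Import all_classical all_reals all_analysis.

Set Implicit Arguments.
Unset Strict Implicit.
Unset Printing Implicit Defensive.

Import Order.TTheory GRing.Theory Num.Theory.
Import numFieldNormedType.Exports.

Local Open Scope classical_set_scope.
Local Open Scope ring_scope.

Definition mean (R : realType) (mu : probability nat R) : \bar R :=
  'E_mu[fun n : nat => n%:R]%E.

(* Probability measures on nat carry the total variation metric, so measurability
   refers to the Borel sigma-algebra of tv_dist rather than to the evaluation
   sigma-algebra of pprobability. *)
Definition tv_dist (R : realType) (p q : probability nat R) : \bar R :=
  ereal_sup [set (p A - q A)%E | A in @measurable _ nat].

Definition tv_open (R : realType) : set (set (probability nat R)) :=
  [set U | forall p, U p ->
    exists2 e : R, 0 < e & forall q, (tv_dist p q < e%:E)%E -> U q].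

Definition tv_measurable (R : realType)
    (psi : probability nat R -> probability nat R) : Prop :=
  measurable_fun setT
    (psi : g_sigma_algebraType (@tv_open R) -> g_sigma_algebraType (@tv_open R)).

Definition mutually_independent (d d' : measure_display)
    (Omega : measurableType d) (T : measurableType d') (R : realType)
    (P : probability Omega R) (X : nat -> Omega -> T) : Prop :=
  forall (J : {fset nat}) (A : nat -> set T), (forall i, measurable (A i)) ->
    P (\bigcap_(i in [set` J]) (X i @^-1` A i)) =
    (\prod_(i <- J) P (X i @^-1` A i))%E.

Definition queue_update (x b : nat) : nat := (x - (0 < x) + b)%N.

(* B t is the number of arrivals between times t and t+1. That it is generated
   independently of everything else amounts to the mutual independence of
   eta 0, B 0, B 1, and so on. *)
Definition nonlinear_process (d : measure_display) (Omega : measurableType d)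
    (R : realType) (P : probability Omega R)
    (psi : probability nat R -> probability nat R)
    (eta B : nat -> {RV P >-> nat}) : Prop :=
  [/\ forall t, distribution P (B t) = psi (distribution P (eta t))
                  :> probability nat R,
      forall t w, eta t.+1 w = queue_update (eta t w) (B t w)
    & mutually_independent P
        (fun i => if i is t.+1 then B t : Omega -> nat else eta 0%N)].

Definition queue_kernel (R : realType) (mu : probability nat R)
    (x : nat) (A : set nat) : \bar R :=
  mu [set b | A (queue_update x b)].

Definition queue_invariant (R : realType) (mu pi : probability nat R) : Prop :=
  forall A : set nat, measurable A -> (\int[pi]_x queue_kernel mu x A)%E = pi A.

(* When psi q has mean < 1, the queue with arrival law psi q has exactly one
   invariant probability measure pi_(psi q); hence this is the set of the
   pi_(psi q) for such q. *)
Definition queue_invariant_laws (R : realType)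
    (psi : probability nat R -> probability nat R) : set (probability nat R) :=
  [set pi | exists q, (mean (psi q) < 1)%E /\ queue_invariant (psi q) pi].

Definition mean_condition (R : realType)
    (psi : probability nat R -> probability nat R) : Prop :=
  (forall q, mean (psi q) = (1 - q [set 0%N])%E) /\
  (forall q q' : probability nat R,
     q [set 0%N] = q' [set 0%N] -> psi q = psi q').

(* The condition is required of every realization of B and of the Bernoulli
   variables (X k is the (k+1)-st one, and true counts as 1). *)
Definition thinning_condition (R : realType)
    (psi : probability nat R -> probability nat R) : Prop :=
  forall (q : probability nat R) (p : R), 0 <= p <= 1 ->
  forall (d : measure_display) (Omega : measurableType d)
    (P : probability Omega R) (B : {RV P >-> nat}) (X : nat -> {RV P >-> bool}),
    distribution P B = psi q :> probability nat R ->
    (forall k, distribution P (X k) = bernoulli_prob p :> probability bool R) ->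
    mutually_independent P
      (fun i w => if i is k.+1 then nat_of_bool (X k w) else B w) ->
    exists q' : probability nat R, forall A : set nat, measurable A ->
      P [set w | A (\sum_(k < B w) X k w)%N] = psi q' A.

Definition weakly_converges (R : realType) (mu : nat -> probability nat R)
    (nu : probability nat R) : Prop :=
  forall f : nat -> R, continuous f -> [bounded f n | n in [set: nat]] ->
    'E_(mu t)[f]%E @[t --> \oo] --> 'E_nu[f]%E.

(* Main.v *)
Require Import Defs.
From HB Require Import structures.
From mathcomp Require Import all_boot all_order all_algebra.
From mathcomp Require Import finmap.
From mathcomp Require Import all_classical all_reals all_analysis.
From mathcomp Require Import measurable_realfun.
From mathcomp Require Import ring lra zify.

Set Implicit Arguments.
Unset Strict Implicit.
Unset Printing Implicit Defensive.

Import Order.TTheory GRing.Theory Num.Theory.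
Import numFieldNormedType.Exports.

Local Open Scope classical_set_scope.
Local Open Scope ring_scope.

(** Along the process only the tails a_t(k) = P(eta(t) > k) matter.  The proof
shows that the l1 distance between a_t and the tail of the stationary law never
increases, and that it cannot stay bounded away from 0.

Thinning turns the arrival laws into a one-parameter family.  The law psi q
depends only on the load 1 - q(0), which is also its mean, and thinning the law
of load s with parameter p gives the law of load p s (thinning_psi).  So the
arrival laws increase stochastically with the load (tail_psi_le), and the
probability of having an arrival grows at least linearly with the load as long
as the load stays below some r < 1 (tail_psi_gap).  The thinning condition
speaks about actual random variables; they are built from the digits of a
uniform point of the unit interval (thinning_realization).

Since the mean number of arrivals equals the probability of a departure, the
mean r is conserved (queue_step_mean).  Hence all loads are at most r < 1, and
a stationary law of finite mean is a fixed point of the nonlinear recursion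
itself.  Subtracting the two recursions gives a linear equation for the
difference D_t of the tails: the mass of D_t at i > 0 moves to i - 1 plus an
independent number of arrivals, and the mass at 0, which is the difference of
the two loads, is spread out with the sign it has, because a larger load gives
stochastically more arrivals (queue_step_transport).  So D_t evolves under
substochastic kernels and its l1 norm cannot increase.  Equality of the means
says that D_t has total mass 0: its positive and negative parts are equally
heavy.  The kernels push mass down to 0 with a probability bounded below, so a
fixed fraction of what both parts have in [0, M] meets at 0 after M steps and
cancels.  If D_t did not tend to 0 in l1, its norm would thus drop by a fixed
amount again and again (transport_contraction).

The last argument needs that no mass escapes to infinity.  Since all loads are
at most r, a_t is dominated by the total occupation of a_0 plus the tail of the
arrivals of load r under the queue of load r killed at 0 (drain_dominated).
This majorant is summable as soon as eta(0) and the arrivals have second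
moments.  For eta(0) this follows from its exponential moment; for the arrivals
it follows from the finite mean of the stationary law (stationary_moment), as
thinning multiplies the second factorial moment by p^2 (psi_second_moment). *)

(** * Independent Bernoulli digits of a uniform variable *)

Section independence.
Context d (Omega : measurableType d) d' (T : measurableType d') (R : realType).
Variables (P : probability Omega R) (X : nat -> Omega -> T).

(** A finite subfamily extends to an initial segment by imposing the trivial
constraint setT on the missing indices; on initial segments the product rule is
amenable to induction. *)
Lemma mutually_independent_initialP :
  mutually_independent P X <->
  forall n (A : nat -> set T), (forall i, measurable (A i)) ->
    P (\bigcap_(i < n) (X i @^-1` A i)) = (\prod_(i < n) P (X i @^-1` A i))%E.
Proof.
split=> [indX n A mA|indX J A mA].
  have := indX [fset i in iota 0 n]%fset A mA.
  rewrite (_ : [set` _] = `I_n); last first.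
    by apply/seteqP; split=> i /=; rewrite !inE /= mem_iota add0n.
  move=> ->; rewrite -(big_mkord xpredT (fun i => P (X i @^-1` A i))).
  apply/perm_big/uniq_perm => //; first exact: iota_uniq.
  by move=> i; rewrite !inE /index_iota subn0.
pose n := (\max_(i <- J) i).+1.
have Jn i : i \in J -> (i < n)%N by move=> iJ; rewrite ltnS; exact: leq_bigmax_seq.
pose A' i := if i \in J then A i else [set: T].
have -> : \bigcap_(i in [set` J]) (X i @^-1` A i) =
          \bigcap_(i < n) (X i @^-1` A' i).
  apply/seteqP; split=> w Aw i /=.
    by move=> _; rewrite /A'; case: ifPn => // iJ; exact: Aw.
  by move=> iJ; have := Aw i (Jn i iJ); rewrite /A' /= iJ.
rewrite indX; last by move=> i; rewrite /A'; case: ifPn.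
rewrite -(big_mkord xpredT (fun i => P (X i @^-1` A' i))).
rewrite (bigID (mem J)) /= [X in (_ * X)%E]big1 ?mule1; last first.
  by move=> i /negbTE iJ; rewrite /A' iJ preimage_setT probability_setT.
rewrite -big_filter.
transitivity (\prod_(i <- J) P (X i @^-1` A' i))%E; last first.
  by apply: eq_big_seq => i iJ; rewrite /A' iJ.
apply/perm_big/uniq_perm; [by rewrite filter_uniq// iota_uniq|exact: fset_uniq|].
move=> i; rewrite mem_filter mem_index_iota leq0n /=.
by case: (boolP (i \in J)) => //= /Jn ->.
Qed.

End independence.

Section bernoulli_digits.
Context (R : realType) (p : R).
Hypothesis p01 : 0 <= p <= 1.

(** The map that rescales the subinterval [0, p[ or [p, 1[ containing u to the
whole unit interval.  It preserves the uniform law and makes the branch that was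
taken independent of the image, so that its iterates produce independent digits
of parameter p. *)
Definition digit_shift (u : R) : R := if u < p then u / p else (u - p) / (1 - p).

Definition digit (k : nat) (u : R) : bool := iter k digit_shift u < p.

Definition cylinder (x : seq bool) : set R :=
  [set u | forall i, (i < size x)%N -> digit i u = nth false x i].

Fixpoint cylinder_lo (x : seq bool) : R :=
  match x with
  | [::] => 0
  | b :: x => if b then p * cylinder_lo x else p + (1 - p) * cylinder_lo x
  end.

Fixpoint cylinder_len (x : seq bool) : R :=
  if x is b :: x then bernoulli_pmf p b * cylinder_len x else 1.

Lemma cylinder_bounds x :
  [/\ 0 <= cylinder_lo x, 0 <= cylinder_len x &
      cylinder_lo x + cylinder_len x <= 1].
Proof.
case/andP: p01 => p0 p1; elim: x => [|b x [lo0 len0 lolen]] /=.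
  by split => //; rewrite add0r.
by rewrite /bernoulli_pmf; case: b; split; nra.
Qed.

(** A cylinder is an interval: prescribing one more leading digit applies an
affine contraction of ratio p or 1 - p. *)
Lemma cylinderP x u : 0 <= u < 1 ->
  cylinder x u <->
  cylinder_lo x <= u < cylinder_lo x + cylinder_len x.
Proof.
case/andP: p01 => p0 p1; elim: x u => [|b x IH] u /andP[u0 u1].
  by rewrite /= add0r u0 u1.
rewrite [cylinder_lo _]/= [cylinder_len _]/=.
have digitS i : digit i.+1 u = digit i (digit_shift u) by rewrite /digit iterSr.
have split0 : cylinder (b :: x) u <->
    (u < p) = b /\ cylinder x (digit_shift u).
  split=> [H|[H0 H1] [|i] //= ix]; last by rewrite digitS; exact: H1.
  by split=> [|i ix]; [exact: (H 0%N)|rewrite -digitS; exact: (H i.+1)].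
rewrite split0 {split0}; have [lo0 len0 lolen] := cylinder_bounds x.
have [up|pu] := ltP u p.
  have pp : 0 < p by exact: le_lt_trans up.
  have sE : digit_shift u = u / p by rewrite /digit_shift up.
  have s01 : 0 <= digit_shift u < 1.
    by rewrite sE divr_ge0//= ltr_pdivrMr// mul1r.
  case: b; last first.
    split=> [[]//|/andP[+ _]]; have: 0 <= (1 - p) * cylinder_lo x by nra.
    lra.
  rewrite (IH _ s01) sE ler_pdivlMr// ltr_pdivrMr// /bernoulli_pmf.
  by rewrite -mulrDr ![p * _]mulrC; split=> [[]|].
have pp : 0 < 1 - p by lra.
have sE : digit_shift u = (u - p) / (1 - p) by rewrite /digit_shift ltNge pu.
have s01 : 0 <= digit_shift u < 1.
  by rewrite sE divr_ge0 ?subr_ge0//= ltr_pdivrMr// mul1r; lra.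
case: b.
  split=> [[]//|/andP[_]]; rewrite /bernoulli_pmf.
  have: p * cylinder_lo x + p * cylinder_len x <= p by nra.
  lra.
rewrite (IH _ s01) sE ler_pdivlMr// ltr_pdivrMr// /bernoulli_pmf.
rewrite ![(1 - p) * _]mulrC mulrDl.
by split=> [[_ /andP[? ?]]|/andP[? ?]]; [|split=> //]; apply/andP; split; lra.
Qed.

Lemma measurable_digit k : measurable_fun setT (digit k).
Proof.
have mshift : measurable_fun setT digit_shift.
  apply: measurable_fun_ifT => //=; first exact: measurable_fun_ltr.
  - exact: measurable_funM.
  - by apply: measurable_funM => //; exact: measurable_funB.
apply: measurable_fun_ltr => //.
by elim: k => [|k IH]; [exact: measurable_id|exact: (measurableT_comp mshift IH)].
Qed.

Lemma measurable_digit_preimage k (A : set bool) : measurable (digit k @^-1` A).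
Proof. by rewrite -[X in measurable X]setTI; exact: measurable_digit. Qed.

Local Notation U := (uniform_prob (@ltr01 R)).

Lemma uniform_itv a b : 0 <= a -> 0 <= b -> a + b <= 1 ->
  U `[a, a + b[ = b%:E.
Proof.
move=> a0 b0 ab1; rewrite /uniform_prob.
rewrite (eq_integral (cst 1%E)); last first.
  move=> x; rewrite inE /= in_itv /= => /andP[ax xb].
  by rewrite /uniform_pdf subr0 invr1 ifT//; apply/andP; split; lra.
rewrite integral_cst//= mul1e lebesgue_measure_itv/= lte_fin.
by case: ltP => [_|?]; rewrite ?EFinN -?EFinB; congr EFin; lra.
Qed.

(** The digits code the points of [0, 1[, while the uniform law lives on [0, 1]. *)
Lemma uniform_restrict E : measurable E -> U E = U (E `&` `[0, 1[).
Proof.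
move=> mE; have U1 : U `[0, 1[ = 1%E.
  by have := @uniform_itv 0 1 (lexx _) ler01; rewrite add0r => ->.
have: U (~` `[0, 1[) = 0%E.
  by rewrite (etrans (probability_setC _ _) (congr1 (fun x => 1 - x)%E U1)) ?subee.
move=> UC; rewrite -[in LHS](setIT E) -(setUv `[0, 1[) setIUr measureU//.
- rewrite [X in (_ + X)%E](_ : _ = 0%E) ?adde0//.
  apply/eqP; rewrite eq_le measure_ge0 andbT -UC.
  by apply: le_measure; rewrite ?inE//; [apply: measurableI => //|]; exact: measurableC.
- exact: measurableI.
- by apply: measurableI => //; exact: measurableC.
- by rewrite setIACA setICr setI0.
Qed.

Lemma measurable_cylinder x : measurable (cylinder x).
Proof.
rewrite (_ : cylinder x =
    \bigcap_(i < size x) (digit i @^-1` [set nth false x i])).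
  by apply: bigcap_measurableType => i _; exact: measurable_digit_preimage.
by apply/seteqP; split.
Qed.

Lemma uniform_cylinder x : U (cylinder x) = (cylinder_len x)%:E.
Proof.
have mE := measurable_cylinder x.
have [lo0 len0 lolen] := cylinder_bounds x.
rewrite uniform_restrict// -(uniform_itv lo0 len0 lolen); congr (U _).
apply/seteqP; split=> u; rewrite /= !in_itv /=.
  by move=> [Eu u01]; apply/cylinderP.
move=> ux; have u01 : 0 <= u < 1 by case/andP: ux => ? ?; apply/andP; split; lra.
by split=> //; apply/cylinderP.
Qed.

Lemma measure_split_bool d (T : measurableType d) (mu : {measure set T -> \bar R})
    (X : T -> bool) (E : set T) (A : set bool) :
  measurable_fun setT X -> measurable E ->
  mu (E `&` X @^-1` A) =
  ((true \in A)%:R%:E * mu (E `&` X @^-1` [set true]) +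
   (false \in A)%:R%:E * mu (E `&` X @^-1` [set false]))%E.
Proof.
move=> mX mE; have mEX b : measurable (E `&` X @^-1` [set b]).
  by apply: measurableI => //; rewrite -[X in measurable X]setTI; exact: mX.
have -> : E `&` X @^-1` A =
   (if true \in A then E `&` X @^-1` [set true] else set0) `|`
   (if false \in A then E `&` X @^-1` [set false] else set0).
  apply/seteqP; split=> w /=.
    move=> [Ew]; case Xw : (X w) => Aw; [left|right]; rewrite ifT ?inE//.
  by case=> [|]; case: ifPn => //; rewrite inE => Ab [Ew Xw]; split; rewrite ?Xw.
rewrite measureU.
- by case: ifP; case: ifP; rewrite ?measure0 ?mul1e ?mul0e.
- by case: ifP.
- by case: ifP.
- apply/seteqP; split=> // w [] /=.
  by case: ifP => // _ [_ Xt]; case: ifP => // _ [_]; rewrite /= Xt.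
Qed.

Lemma cylinder_len_rcons x b :
  cylinder_len (rcons x b) = cylinder_len x * bernoulli_pmf p b.
Proof.
by elim: x => [|c x IH] /=; rewrite ?mul1r ?mulr1// IH mulrA.
Qed.

Lemma cylinder_rconsE x b :
  cylinder (rcons x b) = cylinder x `&` digit (size x) @^-1` [set b].
Proof.
apply/seteqP; split=> u /=; rewrite /cylinder /= size_rcons.
  move=> H; split=> [i ix|]; last by rewrite (H _ (ltnSn _)) nth_rcons ltnn eqxx.
  by rewrite H ?nth_rcons ?ix//; exact: ltnW.
move=> [H Hb] i; rewrite ltnS leq_eqVlt => /predU1P[->|ix].
  by rewrite nth_rcons ltnn eqxx.
by rewrite nth_rcons ix; exact: H.
Qed.

(** Generalizes uniform_cylinder by letting the first digits be prescribed
exactly and the next ones only up to a set: the induction moves one digit from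
the second group to the first. *)
Lemma uniform_cylinder_digits m x (A : nat -> set bool) :
  U (cylinder x `&`
     \bigcap_(i < m) (digit (size x + i) @^-1` A i)) =
  ((cylinder_len x)%:E * \prod_(i < m) bernoulli_prob p (A i))%E.
Proof.
elim: m x A => [|m IH] x A.
  by rewrite bigcap_mkord !big_ord0 setIT mule1 uniform_cylinder.
set C := cylinder x.
pose rest := \bigcap_(i < m) (digit ((size x).+1 + i) @^-1` A i.+1).
have -> : C `&` \bigcap_(i < m.+1) (digit (size x + i) @^-1` A i) =
          (C `&` rest) `&` digit (size x) @^-1` A 0%N.
  rewrite -setIA; congr (_ `&` _); apply/seteqP; split=> [u Hu|u [Hu H0]].
    split=> [i im|]; last by have := Hu 0%N isT; rewrite addn0.
    by have := Hu i.+1 im; rewrite addnS.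
  by move=> [|i] im; [rewrite addn0|rewrite addnS; exact: (Hu i)].
have mrest : measurable (C `&` rest).
  apply: measurableI; first exact: measurable_cylinder.
  by apply: bigcap_measurableType => i _; exact: measurable_digit_preimage.
rewrite (measure_split_bool U (A 0%N) (measurable_digit (size x)) mrest).
have UE b : U ((C `&` rest) `&` digit (size x) @^-1` [set b]) =
    ((cylinder_len x * bernoulli_pmf p b)%:E *
     \prod_(i < m) bernoulli_prob p (A i.+1))%E.
  rewrite -cylinder_len_rcons -(IH (rcons x b) (fun i => A i.+1)) setIAC.
  rewrite -cylinder_rconsE; congr (U (_ `&` _)).
  by apply: eq_bigcapr => i _; rewrite size_rcons.
apply: (etrans (congr2 (fun a b => (_ * a + _ * b)%E) (UE true) (UE false))).
have [_ len0 _] := cylinder_bounds x.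
case/andP: p01 => p0 p1.
rewrite big_ord_recl !muleA -!EFinM -ge0_muleDl ?lee_fin; last 2 first.
- by rewrite !mulr_ge0.
- by rewrite !mulr_ge0// subr_ge0.
congr (_ * _)%E; rewrite bernoulli_probE// !diracE/= -?EFinM -?EFinD.
by congr EFin; rewrite /bernoulli_pmf /unstable.onem; ring.
Qed.

End bernoulli_digits.

(** Two probabilities with the same values are equal as bundled structures, since
all the other fields are proofs. *)
Lemma probability_eq d (T : measurableType d) (R : realType)
  (P Q : probability T R) : P =1 Q -> P = Q.
Proof.
case: P Q => [P cP] [Q cQ] /= /funext PQ; case: _ / PQ in cQ *; congr Probability.Pack.
case: cP => [[u1 u2] [u3] [u4] [u5] [u6] [u7] [u8]].
case: cQ => [[v1 v2] [v3] [v4] [v5] [v6] [v7] [v8]].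
rewrite (Prop_irrelevance v1 u1) (Prop_irrelevance v2 u2).
rewrite (Prop_irrelevance v4 u4) (Prop_irrelevance v5 u5).
rewrite (Prop_irrelevance v6 u6) (Prop_irrelevance v7 u7) (Prop_irrelevance v8 u8).
by rewrite (Prop_irrelevance v3 u3).
Qed.

Section realization.
Context (R : realType) (mu : probability nat R) (p : R).
Hypothesis p01 : 0 <= p <= 1.
Local Notation U := (uniform_prob (@ltr01 R)).

Lemma thinning_realization : exists d (Omega : measurableType d)
    (P : probability Omega R) (B : {RV P >-> nat}) (X : nat -> {RV P >-> bool}),
  [/\ distribution P B = mu :> probability nat R,
      forall k, distribution P (X k) = bernoulli_prob p :> probability bool R &
      mutually_independent P
        (fun i w => if i is k.+1 then nat_of_bool (X k w) else B w)].
Proof.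
pose Omega := (nat * measurableTypeR R)%type.
pose P : probability Omega R := (mu \x U)%E.
have mB : measurable_fun setT (fst : Omega -> nat) by exact: measurable_fst.
have mX k : measurable_fun setT (fun w : Omega => digit p k w.2).
  by apply: measurableT_comp; [exact: measurable_digit|exact: measurable_snd].
pose B : {mfun Omega >-> nat} :=
  HB.pack (fst : Omega -> nat) (isMeasurableFun.Build _ _ _ _ _ mB).
pose X k : {mfun Omega >-> bool} :=
  HB.pack (fun w : Omega => digit p k w.2) (isMeasurableFun.Build _ _ _ _ _ (mX k)).
exists _, Omega, P, B, X.
have Udigits m A : U (\bigcap_(i < m) (digit p i @^-1` A i)) =
    (\prod_(i < m) bernoulli_prob p (A i))%E.
  have := uniform_cylinder_digits p01 m [::] A.
  by rewrite mul1e (_ : cylinder p [::] = setT) ?setTI//; apply/seteqP.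
have mdig i A : measurable (digit p i @^-1` A : set (measurableTypeR R)).
  exact: measurable_digit_preimage.
have Udigit k A : U (digit p k @^-1` A) = bernoulli_prob p A.
  have := Udigits k.+1 (fun i => if i == k then A else setT).
  rewrite (_ : \bigcap_(i < k.+1) _ = digit p k @^-1` A); last first.
    apply/seteqP; split=> [u /(_ k (ltnSn k))|u /= Au i]; rewrite /= ?eqxx//.
    by move=> _; case: eqP => [->|].
  move=> ->; rewrite (bigD1 ord_max)//= eqxx big1 ?mule1// => i.
  by rewrite -val_eqE /= => /negbTE ->; rewrite probability_setT.
have Prect A C : measurable C -> P (A `*` C) = (mu A * U C)%E.
  by move=> mC; rewrite /P /= product_measure1E.
split.
- apply: probability_eq => A; rewrite /= /distribution /pushforward.
  transitivity (P (A `*` setT)); last first.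
    by rewrite Prect// probability_setT mule1.
  by congr (P _); apply/seteqP; split=> w //= [].
- move=> k; apply: probability_eq => A; rewrite /= /distribution /pushforward.
  transitivity (P (setT `*` (digit p k @^-1` A))).
    by congr (P _); apply/seteqP; split=> w //= [].
  by rewrite Prect// probability_setT mul1e; exact: Udigit.
apply/mutually_independent_initialP => n A mA.
case: n => [|n].
  by rewrite bigcap_mkord !big_ord0; exact: probability_setT.
pose A' i := nat_of_bool @^-1` A i.+1.
transitivity (P (A 0%N `*` \bigcap_(i < n) (digit p i @^-1` A' i))).
  congr (P _); apply/seteqP; split=> [w Hw|w [H0 Hw] [|i] im //].
    by split=> [|i im]; [exact: (Hw 0%N)|exact: (Hw i.+1)].
  exact: Hw.
rewrite Prect; last by apply: bigcap_measurableType => i _; exact: mdig.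
rewrite big_ord_recl /=; congr (_ * _)%E.
  transitivity (P (A 0%N `*` setT)); first by rewrite Prect// probability_setT mule1.
  by congr (P _); apply/seteqP; split=> w //= [].
rewrite [LHS]Udigits; apply: eq_bigr => i _; rewrite -(Udigit i).
transitivity (P (setT `*` (digit p i @^-1` A' i))).
  by rewrite Prect// probability_setT mul1e.
by congr (P _); apply/seteqP; split=> w //= [].
Qed.
End realization.

(** * Tails of laws on the natural numbers *)

Definition tail (R : realType) (p : probability nat R) (k : nat) : R :=
  fine (p [set n | (k < n)%N]).

Definition mass (R : realType) (p : probability nat R) (k : nat) : R :=
  fine (p [set k]).

(** If a is the tail of a law, jump a is its mass function; the value 1 at index 0
is the tail at -1. *)
Definition jump (R : realType) (a : nat -> R) (k : nat) : R :=
  (if k is j.+1 then a j else 1) - a k.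

(** The tail of the sum of two independent variables with tails a and b, obtained
by conditioning on the value of the first one. *)
Definition conv_tail (R : realType) (a b : nat -> R) (k : nat) : R :=
  a k + \sum_(i < k.+1) jump a i * b (k - i)%N.

Section tails.
Context (R : realType).
Implicit Types (p : probability nat R) (k n : nat).

Lemma tailE p k : p [set n | (k < n)%N] = (tail p k)%:E.
Proof. by rewrite fineK// fin_num_measure. Qed.

Lemma massE p k : p [set k] = (mass p k)%:E.
Proof. by rewrite fineK// fin_num_measure. Qed.

Lemma tail_ge0 p k : 0 <= tail p k.
Proof. by rewrite -lee_fin -tailE measure_ge0. Qed.

Lemma mass_ge0 p k : 0 <= mass p k.
Proof. by rewrite -lee_fin -massE measure_ge0. Qed.

Lemma tail_le1 p k : tail p k <= 1.
Proof. by rewrite -lee_fin -tailE probability_le1. Qed.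

Lemma mass0E p : mass p 0 = 1 - tail p 0.
Proof.
apply: EFin_inj; rewrite -massE EFinB -tailE.
rewrite (_ : [set 0%N] = ~` [set n | (0 < n)%N]); first exact: probability_setC.
by apply/seteqP; split=> n /=; lia.
Qed.

Lemma massSE p k : mass p k.+1 = tail p k - tail p k.+1.
Proof.
apply/eqP; rewrite eq_sym subr_eq eq_sym; apply/eqP/EFin_inj.
rewrite EFinD -massE -!tailE.
rewrite (_ : [set n | (k < n)%N] = [set k.+1] `|` [set n | (k.+1 < n)%N]).
  by rewrite measureU//; apply/seteqP; split=> // n [/= ->]; rewrite ltnn.
apply/seteqP; split=> n /=; last by case=> [->|/ltnW].
by rewrite leq_eqVlt => /predU1P[->|]; [left|right].
Qed.

Lemma tail_le p k n : (k <= n)%N -> tail p n <= tail p k.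
Proof.
move=> kn; rewrite -lee_fin -!tailE; apply: le_measure; rewrite ?inE//.
by move=> m /=; exact: leq_ltn_trans.
Qed.

Lemma integral_natE p (f : nat -> \bar R) : (forall n, (0 <= f n)%E) ->
  (\int[p]_n f n = \sum_(n <oo) f n * p [set n])%E.
Proof.
move=> f0; rewrite -[X in integral _ X](_ : \bigcup_n [set n] = setT); last first.
  by apply/seteqP; split=> // n _; exists n.
rewrite ge0_integral_bigcup//=; last first.
  apply/trivIsetP => i j _ _ ij; apply/seteqP; split=> // n [/= -> /eqP].
  by rewrite (negbTE ij).
apply: eq_eseriesr => n _; rewrite (eq_integral (cst (f n))); last first.
  by move=> m; rewrite inE /= => ->.
by rewrite integral_cst.
Qed.

End tails.

Section layer_cake.
Context d (T : measurableType d) (R : realType) (P : probability T R).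

Lemma integral_random_sum (g : T -> nat) (h : nat -> T -> R) :
  measurable_fun setT g -> (forall k, measurable_fun setT (h k)) ->
  (forall k x, 0 <= h k x) ->
  (\int[P]_x (\sum_(k < g x) h k x)%:E =
   \sum_(k <oo) \int[P]_x (h k x * \1_[set x | (k < g x)%N] x)%:E)%E.
Proof.
move=> mg mh h0.
have mS k : measurable [set x | (k < g x)%N].
  by have := mg measurableT [set n | (k < n)%N] I; rewrite setTI.
rewrite -integral_nneseries//; last 2 first.
- move=> k; apply/measurable_EFinP.
  exact: (measurable_funM (mh k) (measurable_indic (mS k))).
- by move=> k x _; rewrite lee_fin mulr_ge0.
apply: eq_integral => x _.
rewrite (nneseries_split 0 (g x)); last first.
  by move=> k _; rewrite lee_fin mulr_ge0.
rewrite add0n [X in (_ + X)%E]eseries0 ?adde0.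
  rewrite -sumEFin big_mkord; apply: eq_bigr => k _.
  by rewrite indicE mem_set ?mulr1//=.
by move=> k gk _; rewrite indicE memNset ?mulr0//= ltnNge gk.
Qed.

Lemma layer_cake (g : T -> nat) (w : nat -> R) : measurable_fun setT g ->
  (forall k, 0 <= w k) ->
  (\int[P]_x (\sum_(k < g x) w k)%:E =
   \sum_(k <oo) (w k)%:E * P [set x | (k < g x)%N])%E.
Proof.
move=> mg w0; rewrite (integral_random_sum (h := fun k _ => w k))//.
have mS k : measurable [set x | (k < g x)%N].
  by have := mg measurableT [set n | (k < n)%N] I; rewrite setTI.
apply: eq_eseriesr => k _; under eq_integral do rewrite EFinM.
rewrite ge0_integralZl//.
- by rewrite integral_indic// setIT.
- by apply/measurable_EFinP; exact: measurable_indic.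
- by rewrite lee_fin.
Qed.

Lemma layer_cake1 (g : T -> nat) : measurable_fun setT g ->
  (\int[P]_x (g x)%:R%:E = \sum_(k <oo) P [set x | (k < g x)%N])%E.
Proof.
move=> mg; have := layer_cake mg (fun=> ler01).
under eq_integral do rewrite sumr_const card_ord.
by move=> ->; apply: eq_eseriesr => k _; rewrite mul1e.
Qed.

End layer_cake.

Lemma meanE (R : realType) (p : probability nat R) :
  mean p = (\int[p]_n n%:R%:E)%E.
Proof. by rewrite /mean unlock. Qed.

Lemma mean_tail (R : realType) (p : probability nat R) :
  mean p = (\sum_(k <oo) (tail p k)%:E)%E.
Proof.
rewrite meanE layer_cake1//; apply: eq_eseriesr => k _; exact: tailE.
Qed.

(** The passage from extended real sums to limits of real partial sums, in which
all the estimates on tails are carried out. *)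
Lemma nneseries_fin_cvg (R : realType) (u : nat -> R) (r : R) :
  (forall k, 0 <= u k) -> (\sum_(k <oo) (u k)%:E = r%:E)%E ->
  series u @ \oo --> r.
Proof.
move=> u0 ur.
have /fine_cvgP[_] : (fun n => \sum_(0 <= k < n) (u k)%:E)%E @ \oo --> r%:E.
  by rewrite -ur; apply: is_cvg_nneseries => k _ _; rewrite lee_fin.
by apply: cvg_trans; apply: near_eq_cvg; apply: nearW => n /=; rewrite sumEFin.
Qed.

Lemma mean_tail_cvg (R : realType) (p : probability nat R) (r : R) :
  mean p = r%:E -> series (tail p) @ \oo --> r.
Proof. by rewrite mean_tail; apply: nneseries_fin_cvg => k; exact: tail_ge0. Qed.

(** * One step of the queue *)

(** The common form of the evolution of the nonlinear process, where mu = psi p,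
and of stationarity, where p' = p. *)
Definition queue_step (R : realType) (mu p p' : probability nat R) :=
  forall A : set nat, p' A = (\int[p]_x queue_kernel mu x A)%E.

Section queue_step.
Context (R : realType) (mu p p' : probability nat R).
Hypothesis step : queue_step mu p p'.

(** The mean decreases by one with probability p(0, oo) and increases by the mean
number of arrivals.  Both sides are written with additions because the means
may be infinite. *)
Lemma queue_step_mean :
  (mean p' + (tail p 0)%:E = mean p + mean mu)%E.
Proof.
have mf (f : nat -> \bar R) : measurable_fun setT f by [].
have m0 : (0 <= mean mu)%E.
  by rewrite mean_tail; apply: nneseries_ge0 => k _ _; rewrite lee_fin tail_ge0.
have qk0 x A : (0 <= queue_kernel mu x A)%E by exact: measure_ge0.
have -> : mean p' = (\int[p]_x ((x - (0 < x))%:R%:E + mean mu))%E.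
  rewrite mean_tail.
  under eq_eseriesr => k _ do rewrite -tailE step.
  rewrite -integral_nneseries//.
  apply: eq_integral => x _.
  transitivity (\int[mu]_b (queue_update x b)%:R%:E)%E; first by rewrite layer_cake1.
  rewrite /queue_update; under eq_integral do rewrite natrD EFinD.
  rewrite ge0_integralD//.
  by rewrite integral_cst//= probability_setT mule1 -meanE.
have -> : (tail p 0)%:E = (\int[p]_x (\1_[set n | (0 < n)%N] x)%:E)%E.
  by rewrite integral_indic// setIT; exact/esym/tailE.
rewrite -ge0_integralD//; last by move=> x _; rewrite adde_ge0 ?lee_fin.
under eq_integral => x _.
  rewrite addeAC -EFinD indicE; over.
rewrite ge0_integralD//.
rewrite integral_cst//= probability_setT mule1 meanE; congr (_ + _)%E.
apply: eq_integral => x _; rewrite -natrD; congr (_%:R%:E).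
case: x => [|x]; rewrite ?subn0 ?subn1 /=; first by rewrite memNset.
by rewrite mem_set//= addn1.
Qed.

(** The shifted tail is that of the queue length after the departure, to which the
arrivals are added independently. *)
Lemma queue_step_tail k :
  tail p' k = conv_tail (fun i => tail p i.+1) (tail mu) k.
Proof.
apply: EFin_inj; rewrite -tailE step.
have drainedE i :
    p [set x | x - (0 < x) = i]%N = (jump (fun i => tail p i.+1) i)%:E.
  rewrite /jump; case: i => [|i].
    rewrite EFinB -tailE.
    rewrite (_ : [set x | _] = ~` [set n | (1 < n)%N]); first exact: probability_setC.
    by apply/seteqP; split=> n /=; lia.
  rewrite -massSE -massE; congr (p _); apply/seteqP; split=> n /=; lia.
rewrite (eq_integral (fun x => (\1_[set x | (k.+1 < x)%N] x)%:E +
    \sum_(i < k.+1) (tail mu (k - i))%:E *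
      (\1_[set x | x - (0 < x) = i]%N x)%:E)%E).
  rewrite ge0_integralD//; last first.
    move=> x _; apply: sume_ge0 => i _.
    by rewrite -EFinM lee_fin mulr_ge0// tail_ge0.
  rewrite integral_indic// setIT EFinD; congr (_ + _)%E; first exact: tailE.
  rewrite ge0_integral_sum//; last first.
    by move=> i x _; rewrite -EFinM lee_fin mulr_ge0// tail_ge0.
  rewrite -sumEFin; apply: eq_bigr => i _.
  rewrite ge0_integralZl ?lee_fin ?tail_ge0//.
  rewrite integral_indic// setIT mulrC EFinM; congr (_ * _)%E.
  exact: drainedE.
move=> x _; rewrite /queue_kernel indicE.
have [kx|xk] := ltnP k.+1 x.
  rewrite mem_set// big1 ?adde0; last first.
    by move=> i _; rewrite indicE memNset ?mule0//=; have := ltn_ord i; lia.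
  rewrite -(probability_setT mu); congr (mu _); apply/seteqP; split=> // b _ /=.
  by rewrite /queue_update; lia.
rewrite memNset ?add0e; last by rewrite /=; lia.
have xi : (x - (0 < x) < k.+1)%N by lia.
rewrite (bigD1 (Ordinal xi))//= indicE mem_set// mule1 big1 ?adde0; last first.
  move=> i; rewrite -val_eqE indicE /= => ix.
  by rewrite memNset ?mule0//=; move: ix; lia.
rewrite -tailE; congr (mu _); apply/seteqP; split=> b /=; rewrite /queue_update; lia.
Qed.

End queue_step.

Section process.
Context d (Omega : measurableType d) (R : realType) (P : probability Omega R).
Variables (psi : probability nat R -> probability nat R).
Variables (eta B : nat -> {RV P >-> nat}).
Hypothesis proc : nonlinear_process psi eta B.

Let mE (X : {RV P >-> nat}) (A : set nat) : measurable (X @^-1` A).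
Proof. by rewrite -[X in measurable X]setTI; exact: measurable_funP. Qed.

Let etaS t (A : set nat) : eta t.+1 @^-1` A =
  \bigcup_x (eta t @^-1` [set x] `&` B t @^-1` [set b | A (queue_update x b)]).
Proof.
have [_ etaE _] := proc; apply/seteqP; split=> w /=.
  by rewrite etaE => Aw; exists (eta t w).
by move=> [x _ [/= <-]]; rewrite etaE.
Qed.

Let rest t n (C : nat -> set nat) := \bigcap_(j < n) (B (t + j)%N @^-1` C j).

(* The event is cut according to the value of eta(t), which turns the condition
   on eta(t+1) into one on B(t), the first of the remaining arrivals. *)
Let process_split t n (A : set nat) (C : nat -> set nat) :
  P (eta t.+1 @^-1` A `&` rest t.+1 n C) =
  (\sum_(x <oo) P (eta t @^-1` [set x] `&`
     rest t n.+1
       (fun j => if j is i.+1 then C i else [set b | A (queue_update x b)])))%E.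
Proof.
rewrite etaS setI_bigcupl measure_bigcup//=.
- rewrite (@eq_eseriesl _ _ xpredT); last by move=> x; rewrite in_setT.
  apply: eq_eseriesr => x _; rewrite -setIA; congr (P (_ `&` _)).
  apply/seteqP; split=> w /=.
    move=> [Bw Hw] [|j] jn /=; first by rewrite addn0.
    by have := Hw j jn; rewrite addSnnS.
  move=> Hw; split; first by have := Hw 0%N isT; rewrite addn0.
  by move=> j jn; have := Hw j.+1 jn; rewrite addSnnS.
- by move=> x _; apply: measurableI; [exact: measurableI|exact: bigcap_measurableType].
- by move=> i j _ _ [w [[[/= <- _] _] [[/= <- _] _]]].
Qed.

(** As eta(t) is a function of eta(0), B(0), ..., B(t-1), it is independent of the
arrivals from time t on; carrying all the later arrivals along makes the
statement inductive in t. *)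
Lemma process_independent t n (A : set nat) (C : nat -> set nat) :
  P (eta t @^-1` A `&` rest t n C) =
  (P (eta t @^-1` A) * \prod_(j < n) P (B (t + j)%N @^-1` C j))%E.
Proof.
have [_ _ /mutually_independent_initialP ind] := proc.
elim: t n A C => [|t IH] n A C.
  have := ind n.+1 (fun i => if i is j.+1 then C j else A) (fun=> I).
  rewrite big_ord_recl => <-; congr (P _).
  apply/seteqP; split=> w /=.
    by move=> [? H] [|j] //= ?; exact: H.
  by move=> H; split=> [|j jn]; [exact: (H 0%N)|exact: (H j.+1)].
have stepE m D : P (eta t.+1 @^-1` A `&` rest t.+1 m D) =
    ((\sum_(x <oo) P (eta t @^-1` [set x]) *
                  P (B t @^-1` [set b | A (queue_update x b)])) *
     \prod_(j < m) P (B (t.+1 + j)%N @^-1` D j))%E.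
  rewrite process_split muleC.
  rewrite -[X in (X * _)%E]fineK; last first.
    by apply: prode_fin_num => j _; exact: fin_num_measure.
  rewrite -nneseriesZl; last by move=> x _; rewrite mule_ge0.
  apply: eq_eseriesr => x _; rewrite IH big_ord_recl addn0 muleA muleC fineK.
    by congr (_ * _)%E; apply: eq_bigr => j _; rewrite addSnnS.
  by apply: prode_fin_num => j _; exact: fin_num_measure.
rewrite stepE; congr (_ * _)%E.
have := stepE 0%N C; rewrite big_ord0 mule1 => <-.
by rewrite /rest bigcap_mkord big_ord0 setIT.
Qed.

Lemma process_queue_step t :
  queue_step (psi (distribution P (eta t))) (distribution P (eta t))
    (distribution P (eta t.+1)).
Proof.
move=> A; rewrite integral_natE//.
have [Blaw _ _] := proc.
transitivity (P (eta t.+1 @^-1` A `&` rest t.+1 0 (fun=> setT))).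
  by rewrite /rest bigcap_mkord big_ord0 setIT.
rewrite process_split; apply: eq_eseriesr => x _.
rewrite process_independent big_ord_recl big_ord0 mule1 addn0 muleC.
by rewrite /queue_kernel -Blaw.
Qed.

End process.

(** * Convolutions and series *)

Section convolution.
Context (R : realType).
Implicit Types (a b m g : nat -> R).

(** Conditioning on the first or on the second summand gives the same tail.  The
identity is purely algebraic, by summation by parts, so it also holds for
sequences that are not tails of laws. *)
Lemma conv_tailC a b k : conv_tail a b k = conv_tail b a k.
Proof.
have E (x y : nat -> R) : conv_tail x y k =
    x k + y k - \sum_(i < k.+1) x i * y (k - i)%N + \sum_(i < k) x i * y (k.-1 - i)%N.
  rewrite /conv_tail /jump; under eq_bigr do rewrite mulrBl.
  rewrite sumrB big_ord_recl subn0 mul1r.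
  rewrite (_ : \sum_(i < k) _ = \sum_(i < k) x i * y (k.-1 - i)%N); first by ring.
  by apply: eq_bigr => i _; rewrite lift0; congr (_ * y _); lia.
rewrite !E (addrC (b k)); congr (_ - _ + _).
  rewrite (reindex_inj rev_ord_inj); apply: eq_bigr => i _ /=.
  by rewrite mulrC subSS subKn// -ltnS.
rewrite (reindex_inj rev_ord_inj); apply: eq_bigr => i _ /=.
by rewrite mulrC; congr (b _ * a _); have := ltn_ord i; lia.
Qed.

Lemma sum_triangle (f : nat -> nat -> R) n :
  \sum_(k < n) \sum_(j < k.+1) f j (k - j)%N = \sum_(j < n) \sum_(i < n - j) f j i.
Proof.
elim: n => [|n IH]; first by rewrite !big_ord0.
rewrite big_ord_recr /= IH [RHS]big_ord_recr /= subSn// subnn big_ord1.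
rewrite [X in _ + X]big_ord_recr /= subnn addrA -big_split /=; congr (_ + _).
apply: eq_bigr => j _; rewrite subSn; last exact: ltnW.
by rewrite big_ord_recr.
Qed.

Lemma sum_ord_split g n k : (n <= k)%N ->
  \sum_(i < k) g i = \sum_(i < n) g i + \sum_(i < k - n) g (n + i)%N.
Proof.
move=> nk; have [j ->] : exists j, k = (n + j)%N by exists (k - n)%N; lia.
by rewrite big_split_ord addKn.
Qed.

Lemma ler_sum_widen g n k : (forall i, 0 <= g i) -> (n <= k)%N ->
  \sum_(i < n) g i <= \sum_(i < k) g i.
Proof. by move=> g0 /(sum_ord_split g) ->; rewrite lerDl sumr_ge0. Qed.

Lemma sum_conv_le m g n : (forall i, 0 <= m i) -> (forall i, 0 <= g i) ->
  \sum_(k < n) \sum_(j < k.+1) m j * g (k - j)%N <=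
  (\sum_(j < n) m j) * \sum_(i < n) g i.
Proof.
move=> m0 g0; rewrite (sum_triangle (fun j i => m j * g i)) mulr_suml.
apply: ler_sum => j _; rewrite -mulr_sumr ler_wpM2l//.
by apply: ler_sum_widen => //; exact: leq_subr.
Qed.

End convolution.

Section series_bounds.
Context (R : realType).
Implicit Types u : nat -> R.

Lemma sum_le_lim u n : (forall k, 0 <= u k) -> cvgn (series u) ->
  \sum_(k < n) u k <= limn (series u).
Proof.
move=> u0 cu; rewrite -(big_mkord xpredT u).
by apply: (nondecreasing_cvgn_le _ cu); apply: nondecreasing_series => k _ _.
Qed.

Lemma lim_series_le_bound u C : cvgn (series u) ->
  (forall n, \sum_(k < n) u k <= C) -> limn (series u) <= C.
Proof.
move=> cu H; apply: limr_le => //; apply: nearW => n.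
by rewrite /series /= big_mkord.
Qed.

Lemma bounded_series_cvg u C : (forall k, 0 <= u k) ->
  (forall n, \sum_(k < n) u k <= C) -> cvgn (series u).
Proof.
move=> u0 H; apply: nondecreasing_is_cvgn.
  by apply: nondecreasing_series => k _ _.
by exists C => _ [n _ <-]; rewrite /series /= big_mkord.
Qed.

End series_bounds.

(** * Contraction of signed masses under transport *)

Lemma pos_partE (R : realType) (x : R) : Num.max x 0 = (`|x| + x) / 2.
Proof. by case: (leP x 0) => x0; [rewrite ler0_norm//|rewrite gtr0_norm//]; lra. Qed.

Section contraction.
Context (R : realType).
Implicit Types (m rho F G : nat -> R).

Definition subprob m := (forall k, 0 <= m k) /\ (forall n, \sum_(k < n) m k <= 1).

(** The kernel moves mass from i > 0 to i - 1 + j with weight m(j), and from 0 to k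
with weight rho(k). *)
Definition transport m rho F k : R :=
  \sum_(j < k.+1) m j * F (k - j).+1 + F 0%N * rho k.

Lemma transport_ge0 m rho F : subprob m -> subprob rho -> (forall k, 0 <= F k) ->
  forall k, 0 <= transport m rho F k.
Proof.
move=> [m0 _] [r0 _] F0 k; rewrite addr_ge0 ?mulr_ge0//.
by apply: sumr_ge0 => j _; rewrite mulr_ge0.
Qed.

Lemma transport_sum_le m rho F n : subprob m -> subprob rho ->
  (forall k, 0 <= F k) ->
  \sum_(k < n) transport m rho F k <= \sum_(k < n.+1) F k.
Proof.
move=> [m0 m1] [r0 r1] F0; rewrite big_split /= big_ord_recl /= addrC lerD//.
  by rewrite -mulr_sumr; apply: ler_piMr; [exact: F0|exact: r1].
apply: (le_trans (sum_conv_le n m0 (fun i => F0 i.+1))).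
by apply: ler_piMl; [exact: sumr_ge0|exact: m1].
Qed.

(** The interval [0, n+1] keeps a fraction d of its mass one unit lower, because
a state i > 0 goes to i - 1, and 0 stays put, with weight at least d. *)
Lemma transport_sum_ge m rho F d n : subprob m -> subprob rho ->
  (forall k, 0 <= F k) -> d <= m 0%N -> d <= rho 0%N ->
  d * \sum_(k < n.+2) F k <= \sum_(k < n.+1) transport m rho F k.
Proof.
move=> [m0 m1] [r0 r1] F0 dm dr.
rewrite [leLHS]mulr_sumr big_ord_recl /= [leRHS]big_split /= [leRHS]addrC lerD//.
  rewrite [leRHS]big_ord_recl /= -[leLHS]addr0 lerD//; first by rewrite mulrC ler_wpM2l.
  by apply: sumr_ge0 => j _; rewrite mulr_ge0.
apply: ler_sum => k _; rewrite [leRHS]big_ord_recl /= subn0.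
rewrite -[leLHS]addr0 lerD//; first by rewrite ler_wpM2r.
by apply: sumr_ge0 => j _; rewrite mulr_ge0.
Qed.

Lemma transportB m rho F G k :
  transport m rho (F \- G) k = transport m rho F k - transport m rho G k.
Proof.
rewrite /transport /=; under eq_bigr do rewrite mulrBr.
by rewrite sumrB; ring.
Qed.

Fixpoint transports (m rho : nat -> nat -> R) (t n : nat) F : nat -> R :=
  if n is n'.+1
  then transport (m (t + n')%N) (rho (t + n')%N) (transports m rho t n' F)
  else F.

Variables (m rho : nat -> nat -> R) (d : R).
Hypotheses (m1 : forall t, subprob (m t)) (rho1 : forall t, subprob (rho t)).
Hypotheses (d0 : 0 < d) (dm : forall t, d <= m t 0%N) (dr : forall t, d <= rho t 0%N).

Lemma transports_ge0 t n F : (forall k, 0 <= F k) ->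
  forall k, 0 <= transports m rho t n F k.
Proof. by move=> F0; elim: n => //= n IH; apply: transport_ge0. Qed.

Lemma transports_sum_le t n F K : (forall k, 0 <= F k) ->
  \sum_(k < K) transports m rho t n F k <= \sum_(k < K + n) F k.
Proof.
move=> F0; elim: n K => [|n IH] K; first by rewrite addn0.
rewrite addnS -addSn; apply: le_trans (IH _); rewrite /=.
by apply: transport_sum_le => //; exact: transports_ge0.
Qed.

(** In n steps a fraction d^n of the mass in [0, n] has come down to 0. *)
Lemma transports_0_ge t n F : (forall k, 0 <= F k) ->
  d ^+ n * \sum_(k < n.+1) F k <= transports m rho t n F 0%N.
Proof.
move=> F0; rewrite -[leRHS](big_ord1 +%R (fun k : 'I_1 => transports m rho t n F k)).
suff H j : d ^+ n * \sum_(k < (j + n).+1) F k <=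
    \sum_(k < j.+1) transports m rho t n F k by exact: (H 0%N).
elim: n j => [|n IH] j; first by rewrite addn0 mul1r.
rewrite exprS -mulrA addnS -addSn.
apply: le_trans (transport_sum_ge _ _ _ _ (dm _) (dr _)) => //; last first.
  exact: transports_ge0.
by apply: ler_wpM2l; [exact: ltW|exact: (IH j.+1)].
Qed.

Variables (D : nat -> nat -> R) (c : nat -> R).
Hypotheses (DS : forall t k, D t.+1 k = transport (m t) (rho t) (D t) k).
Hypotheses (Dc : forall t k, `|D t k| <= c k) (c_cvg : cvgn (series c)).
Hypotheses (D_sum0 : forall t, series (D t) @ \oo --> 0).

Let c0 k : 0 <= c k. Proof. exact: le_trans (Dc 0 k). Qed.

Let l1 t : R := limn (series (fun k => `|D t k|)).

Let nD0 t k : 0 <= `|D t k|. Proof. by []. Qed.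

Let l1_cvg t : cvgn (series (fun k => `|D t k|)).
Proof. exact: (series_le_cvg (nD0 t) c0 (Dc t) c_cvg). Qed.

Let l1_ge t n : \sum_(k < n) `|D t k| <= l1 t.
Proof. exact: sum_le_lim (nD0 t) (@l1_cvg t). Qed.

Let l1_le t (C : R) : (forall n, \sum_(k < n) `|D t k| <= C) -> l1 t <= C.
Proof. exact: lim_series_le_bound (@l1_cvg t). Qed.

Lemma l1_nonincreasing : nonincreasing_seq l1.
Proof.
apply/nonincreasing_seqP => t; apply: l1_le => n.
apply: le_trans (l1_ge t n.+1).
have nD k : 0 <= `|D t k| by [].
apply: le_trans (transport_sum_le n (m1 t) (rho1 t) nD).
apply: ler_sum => k _; rewrite DS /transport.
apply: le_trans (ler_normD _ _) _; rewrite normrM (ger0_norm ((rho1 t).1 k)) lerD2r.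
apply: le_trans (ler_norm_sum _ _ _) _; apply: ler_sum => j _.
by rewrite normrM (ger0_norm ((m1 t).1 j)).
Qed.

Lemma transports_diff t n k :
  D (t + n)%N k = transports m rho t n (fun k => Num.max (D t k) 0) k
     - transports m rho t n (fun k => Num.max (- D t k) 0) k.
Proof.
elim: n k => [|n IH] k.
  by rewrite addn0 /= !pos_partE normrN; lra.
rewrite addnS DS /= -transportB; congr (transport _ _ _ _).
by apply/funext => i; rewrite IH.
Qed.

(* The positive and negative parts of D_t have the same mass, half of its l1 norm,
   because D_t sums to 0; the tail of the dominating sequence c bounds what lies
   beyond M.  The sign s selects the part. *)
Let half_mass t M (e L s : R) : s = 1 \/ s = -1 -> L <= l1 t ->
  limn (series c) - series c M <= e ->
  L / 2 - e <= \sum_(k < M.+1) Num.max (s * D t k) 0.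
Proof.
move=> s1 Ll ce; set S := \sum_(k < _) _.
suff : l1 t / 2 <= S + e by lra.
have H : (series (fun k => `|D t k|) n + s * series (D t) n) / 2 @[n --> \oo]
    --> (l1 t + s * 0) / 2.
  by apply: cvgMl; apply: cvgD; [exact: l1_cvg|apply: cvgMr; exact: D_sum0].
rewrite mulr0 addr0 in H.
rewrite -(cvg_lim _ H)//; apply: limr_le; first by apply/cvg_ex; eexists; exact: H.
near=> n.
rewrite /series /= !big_mkord mulr_sumr -big_split /= mulr_suml.
rewrite (eq_bigr (fun k : 'I_n => Num.max (s * D t k) 0)); last first.
  by move=> k _; rewrite pos_partE; case: s1 => ->; rewrite ?mul1r ?mulN1r ?normrN.
have Mn : (M.+1 <= n)%N by near: n; exact: nbhs_infty_ge.
rewrite (sum_ord_split (fun k => Num.max (s * D t k) 0) Mn) lerD//.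
apply: le_trans ce.
have cM : \sum_(k < n) c k <= limn (series c) by exact: sum_le_lim.
apply: le_trans (_ : \sum_(k < n) c k - series c M.+1 <= _); last first.
  apply: lerB => //; rewrite /series /= !big_mkord; exact: ler_sum_widen.
rewrite (sum_ord_split c Mn) /series /= big_mkord addrAC subrr add0r.
apply: ler_sum => k _; apply: le_trans (Dc t _); rewrite ge_max normr_ge0 andbT.
by case: s1 => ->; [rewrite mul1r ler_norm|rewrite mulN1r -normrN ler_norm].
Unshelve. all: by end_near. Qed.

(** If the l1 norms decreased to a limit L > 0, each part of D_t would have mass at
least L/4 inside some fixed [0, M].  After M steps both parts put at least
g = d^M L/4 at 0, where they cancel, so the norm would drop by 2g every M steps. *)
Lemma transport_contraction : l1 t @[t --> \oo] --> 0.
Proof.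
have l10 t : 0 <= l1 t by apply: le_trans (l1_ge t 0); rewrite big_ord0.
have l1_cv : cvgn l1.
  by apply: nonincreasing_is_cvgn l1_nonincreasing _; exists 0 => _ [t _ <-].
pose L := limn l1.
have Lle t : L <= l1 t by exact: (nonincreasing_cvgn_ge l1_nonincreasing).
suff -> : 0 = L by exact: l1_cv.
apply/eqP; rewrite eq_le; apply/andP; split.
  by apply: limr_ge => //; exact: nearW.
rewrite leNgt; apply/negP => L0.
have [M cM] : exists M, limn (series c) - series c M <= L / 4.
  have /cvgrPdist_le/(_ (L / 4)) := c_cvg.
  case; first by lra.
  move=> M _ /(_ M (leqnn _)) /= H; exists M.
  exact: le_trans (ler_norm _) H.
pose g := d ^+ M * (L / 4).
have g0 : 0 < g by rewrite mulr_gt0 ?exprn_gt0//; lra.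
have drop t : l1 (t + M)%N <= l1 t - 2 * g.
  pose F k := Num.max (D t k) 0; pose G k := Num.max (- D t k) 0.
  have F0 k : 0 <= F k by rewrite le_max lexx orbT.
  have G0 k : 0 <= G k by rewrite le_max lexx orbT.
  have FM : g <= transports m rho t M F 0%N.
    apply: le_trans (transports_0_ge t M F0).
    apply: ler_wpM2l; first by rewrite exprn_ge0// ltW.
    have := half_mass (or_introl erefl) (Lle t) cM.
    rewrite (eq_bigr (fun k : 'I_M.+1 => F k)) => [H|k _]; last by rewrite /F mul1r.
    by apply: le_trans H; lra.
  have GM : g <= transports m rho t M G 0%N.
    apply: le_trans (transports_0_ge t M G0).
    apply: ler_wpM2l; first by rewrite exprn_ge0// ltW.
    have := half_mass (or_intror erefl) (Lle t) cM.
    rewrite (eq_bigr (fun k : 'I_M.+1 => G k)) => [H|k _]; last by rewrite /G mulN1r.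
    by apply: le_trans H; lra.
  apply: l1_le => K.
  apply: le_trans (_ : \sum_(k < K.+1) `|D (t + M)%N k| <= _).
    exact: (ler_sum_widen (nD0 _) (leqnSn K)).
  have FG K' : \sum_(k < K') F k + \sum_(k < K') G k <= l1 t.
    rewrite -big_split /=; apply: le_trans (l1_ge t K'); apply: ler_sum => k _.
    by rewrite /F /G !pos_partE normrN; lra.
  have sF := transports_sum_le t M K.+1 F0.
  have sG := transports_sum_le t M K.+1 G0.
  have := FG (K.+1 + M)%N.
  suff : \sum_(k < K.+1) `|D (t + M)%N k| <=
      \sum_(k < K.+1) transports m rho t M F k +
      \sum_(k < K.+1) transports m rho t M G k - 2 * g by lra.
  rewrite -big_split /= !(big_ord_recl K) /= [leRHS]addrAC lerD//.
    by rewrite transports_diff -/F -/G; case: ler0P => _; lra.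
  apply: ler_sum => k _; rewrite transports_diff -/F -/G.
  have := transports_ge0 t M F0 (bump 0 k); have := transports_ge0 t M G0 (bump 0 k).
  by rewrite /=; case: ler0P => _; lra.
have /cvgrPdist_lt/(_ g g0)[t _ /(_ t (leqnn t)) /=] := l1_cv.
rewrite -/L distrC => /(le_lt_trans (ler_norm _)) lt.
by have := drop t; have := Lle (t + M)%N; lra.
Qed.

End contraction.

(** * Thinning *)

Section thinned_sum.
Context (R : realType) (mu : probability nat R) (p : R) (d : measure_display)
  (Omega : measurableType d) (P : probability Omega R)
  (B : {RV P >-> nat}) (X : nat -> {RV P >-> bool}).
Hypothesis p01 : 0 <= p <= 1.
Hypothesis Blaw : distribution P B = mu :> probability nat R.
Hypothesis Xlaw : forall k,
  distribution P (X k) = bernoulli_prob p :> probability bool R.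
Hypothesis ind : mutually_independent P
  (fun i w => if i is k.+1 then nat_of_bool (X k w) else B w).

Let mB : measurable_fun setT B. Proof. exact: measurable_funP. Qed.
Let mX k : measurable_fun setT (X k). Proof. exact: measurable_funP. Qed.

Definition thinned_sum (w : Omega) : nat := \sum_(k < B w) X k w.

(** The first n Bernoulli variables with index in Q all take the value b; Q ranges
below over one index, two indices and all of them. *)
Lemma thinning_joint n (A : set nat) (Q : pred nat) (b : bool) :
  P (B @^-1` A `&` \bigcap_(i in [set i | (i < n)%N && Q i]) (X i @^-1` [set b])) =
  (mu A * (bernoulli_pmf p b ^+ count Q (iota 0 n))%:E)%E.
Proof.
have XE i : X i @^-1` [set b] =
    (fun w => nat_of_bool (X i w)) @^-1` [set m | m = nat_of_bool b].
  by apply/seteqP; split=> w /=; case: (X i w); case: b.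
have Xb i : P (X i @^-1` [set b]) = (bernoulli_pmf p b)%:E.
  apply: etrans (congr1 (fun Q : probability bool R => Q [set b]) (Xlaw i)) _ => /=.
  rewrite bernoulli_probE// !diracE /bernoulli_pmf; case: {XE} b.
    by rewrite mem_set// memNset//= mule1 mule0 adde0.
  by rewrite memNset//= mem_set// mule1 mule0 add0e.
pose C i : set nat := if i is k.+1 then
   (if Q k then [set m | m = nat_of_bool b] else setT) else A.
transitivity (P (\bigcap_(i < n.+1)
    ((fun w => if i is k.+1 then nat_of_bool (X k w) else B w) @^-1` C i))).
  congr (P _); apply/seteqP; split=> w.
    move=> [Bw Xw] [|i] //= iltn; case: ifP => // Qi.
    by have -> : X i w = b by apply: (Xw i); rewrite /= Qi andbT.
  move=> H; split; first exact: (H 0%N).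
  move=> i /= /andP[iltn Qi]; have := H i.+1 iltn; rewrite /= Qi /=.
  by case: (X i w); case: b {C H XE Xb}.
rewrite (mutually_independent_initialP P _).1// big_ord_recl; congr (_ * _)%E.
  exact: (congr1 (fun Q : probability nat R => Q A) Blaw).
rewrite (eq_bigr (fun i : 'I_n => (if Q i then bernoulli_pmf p b else 1)%:E));
  last first.
  move=> i _ /=; case: ifP => _; first by rewrite -XE Xb.
  by rewrite preimage_setT probability_setT.
rewrite prodEFin -(big_mkord xpredT (fun i => if Q i then bernoulli_pmf p b else 1)).
by rewrite -big_mkcond big_const_seq /index_iota subn0 iter_mulr_1.
Qed.

Let mS n : measurable_fun setT (fun w => \sum_(k < n) X k w)%N.
Proof.
elim: n => [|n IH].
  by under eq_fun do rewrite big_ord0; exact: measurable_cst.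
under eq_fun do rewrite big_ord_recr /=.
by apply: measurable_fun_addn => //; exact: (measurableT_comp (f := nat_of_bool)).
Qed.

Lemma measurable_thinned_sum : measurable_fun setT thinned_sum.
Proof.
move=> _ A _; rewrite setTI.
rewrite (_ : _ @^-1` _ = \bigcup_n (B @^-1` [set n] `&`
   (fun w => \sum_(k < n) X k w)%N @^-1` A)).
  apply: bigcup_measurable => n _.
  apply: measurableI; rewrite -[X in measurable X]setTI; first exact: mB.
  exact: mS.
apply/seteqP; split=> w /=; first by exists (B w).
by move=> [n _ [/= <-]].
Qed.

Lemma thinned_sum_le w : (thinned_sum w <= B w)%N.
Proof.
rewrite /thinned_sum -[leqRHS]card_ord -sum1_card; apply: leq_sum => k _.
exact: leq_b1.
Qed.

Let joint n (A : set nat) (Q : pred nat) (b : bool) :=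
  B @^-1` A `&` \bigcap_(i in [set i | (i < n)%N && Q i]) (X i @^-1` [set b]).

Let mjoint n A Q b : measurable (joint n A Q b).
Proof.
apply: measurableI; first by rewrite -[X in measurable X]setTI; exact: mB.
by apply: bigcap_measurableType => i _; rewrite -[X in measurable X]setTI; exact: mX.
Qed.

Let count_pred1 k : count (pred1 k) (iota 0 k.+1) = 1%N.
Proof. by rewrite count_uniq_mem ?iota_uniq// mem_iota add0n ltnSn. Qed.

Let count_pred2 j k : (j < k)%N -> count (pred2 j k) (iota 0 k.+1) = 2%N.
Proof.
move=> jk; rewrite -addn1 iotaD count_cat /= add0n eqxx orbT addn0.
rewrite (@eq_in_count _ _ (pred1 j)).
  by rewrite count_uniq_mem ?iota_uniq// mem_iota add0n jk.
by move=> i; rewrite mem_iota /= => /ltn_eqF ->; rewrite orbF.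
Qed.

Lemma mean_thinned_sum :
  (\int[P]_w (thinned_sum w)%:R%:E = p%:E * mean mu)%E.
Proof.
under eq_integral do rewrite natr_sum.
rewrite (integral_random_sum (h := fun k w => (X k w)%:R) P mB)//; last first.
  by move=> k; exact: (measurableT_comp (f := fun b : bool => b%:R : R)).
rewrite mean_tail -nneseriesZl; last by move=> k _; rewrite lee_fin tail_ge0.
apply: eq_eseriesr => k _.
have := thinning_joint k.+1 [set n | (k < n)%N] (pred1 k) true.
rewrite count_pred1 expr1 tailE muleC => <-; rewrite -/(joint _ _ _ _).
rewrite -[joint _ _ _ _]setIT -(integral_indic P measurableT)//.
apply: eq_integral => w _; congr EFin.
rewrite !indicE -natrM mulnb; congr (nat_of_bool _)%:R.
apply/andP/idP; rewrite !inE.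
  by move=> [Xk kB]; split=> //= i /andP[_ /eqP ->].
by move=> [kB /(_ k)]; rewrite /= ltnSn eqxx => ->.
Qed.

(** Both sides count the pairs of retained arrivals among the first n: the right
side sorts them by their larger index. *)
Lemma sum_iota_thinned n w :
  (\sum_(k < \sum_(i < n) X i w) k = \sum_(k < n) X k w * \sum_(j < k) X j w)%N.
Proof.
elim: n => [|n IH]; first by rewrite !big_ord0.
rewrite [in RHS]big_ord_recr /= -IH big_ord_recr /=.
by case: (X n w); rewrite ?addn1 ?addn0 ?big_ord_recr /= ?mul1n ?mul0n ?addn0.
Qed.

(** A pair of arrivals is retained with probability p^2, and the number of pairs of
N arrivals is the sum of k over k < N, whose expectation is given by the layer
cake formula. *)
Lemma binomial_thinned_sum :
  (\int[P]_w (\sum_(k < thinned_sum w) k%:R)%:E =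
   (p ^+ 2)%:E * \sum_(k <oo) (k%:R * tail mu k)%:E)%E.
Proof.
under eq_integral do rewrite -natr_sum sum_iota_thinned natr_sum.
rewrite (integral_random_sum
  (h := fun k w => (X k w * \sum_(j < k) X j w)%:R) P mB)//; last first.
  move=> k; apply: (measurableT_comp (f := fun n : nat => n%:R : R)); first by [].
  have -> : (fun w => X k w * \sum_(j < k) X j w)%N =
    (fun w => if X k w then \sum_(j < k) X j w else 0)%N.
    by apply/funext => w; case: (X k w); rewrite ?mul1n ?mul0n.
  exact: (measurable_fun_ifT (mX k) (mS k) (measurable_cst _)).
rewrite -nneseriesZl; last by move=> k _; rewrite lee_fin mulr_ge0// tail_ge0.
apply: eq_eseriesr => k _.
transitivity (\int[P]_w \sum_(j < k)
    (\1_(joint k.+1 [set n | (k < n)%N] (pred2 (j : nat) k) true) w : R)%:E)%E.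
  apply: eq_integral => w _; rewrite sumEFin natrM natr_sum mulr_sumr mulr_suml.
  congr EFin; apply: eq_bigr => j _; rewrite !indicE -!natrM !mulnb.
  congr (nat_of_bool _)%:R; apply/andP/idP; rewrite !inE.
    by move=> [/andP[Xk Xj] kB]; split=> //= i /andP[_ /orP[] /eqP ->].
  move=> [kB H]; split=> //; apply/andP; split.
    by apply: (H k); rewrite /= ltnSn eqxx orbT.
  by apply: (H j); rewrite /= eqxx ltnS ltnW.
rewrite ge0_integral_sum//; last first.
  by move=> j; apply/measurable_EFinP; apply: measurable_indic; exact: mjoint.
rewrite (eq_bigr (fun=> (p ^+ 2 * tail mu k)%:E)); last first.
  move=> j _; rewrite integral_indic// setIT [LHS]thinning_joint count_pred2//.
  by rewrite tailE EFinM muleC.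
by rewrite sumEFin sumr_const card_ord -EFinM; congr EFin; rewrite mulr_natl mulrnAr.
Qed.

Lemma thinned_sum_eq0 :
  (P [set w | thinned_sum w = 0%N] = \sum_(n <oo) (mass mu n * (1 - p) ^+ n)%:E)%E.
Proof.
rewrite (_ : mkset _ = \bigcup_n joint n [set n] predT false); last first.
  apply/seteqP; split=> w /=.
    move=> /eqP; rewrite sum_nat_eq0 => /forallP H; exists (B w) => //; split=> //.
    move=> i /= /andP[iB _]; have := H (Ordinal iB); rewrite /= eqb0.
    by move=> /negbTE.
  move=> [n _ [/= Bw H]]; apply/eqP; rewrite sum_nat_eq0; apply/forallP => i.
  by rewrite /= (H i)//= -Bw andbT.
rewrite measure_bigcup//=; last by move=> i j _ _ [w [[/= <- _] [/= <- _]]].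
rewrite (@eq_eseriesl _ _ xpredT); last by move=> x; rewrite in_setT.
apply: eq_eseriesr => n _; rewrite [LHS]thinning_joint count_predT size_iota.
by rewrite massE EFinM.
Qed.

End thinned_sum.

(** * The one-parameter family of arrival laws *)

Section thinning_family.
Context (R : realType) (psi : probability nat R -> probability nat R).
Hypotheses (psi_mean : mean_condition psi) (psi_thin : thinning_condition psi).
Implicit Types q : probability nat R.

Lemma mean_psi q : mean (psi q) = (tail q 0)%:E.
Proof. by rewrite psi_mean.1 massE mass0E -EFinB opprB addrC subrK. Qed.

Lemma eq_psi q q' : tail q 0 = tail q' 0 -> psi q = psi q'.
Proof. by move=> qq'; apply: psi_mean.2; rewrite !massE !mass0E qq'. Qed.

(** What the thinning condition gives on the law of load p s: that load is
identified by the mean, and the law is compared with the law of load s through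
its tail, its mean number of pairs of arrivals and its mass at 0. *)
Lemma thinning_psi q (p : R) : 0 <= p <= 1 -> exists q',
  [/\ tail q' 0 = p * tail q 0,
      forall k, tail (psi q') k <= tail (psi q) k,
      (\sum_(k <oo) (k%:R * tail (psi q') k)%:E =
        (p ^+ 2)%:E * \sum_(k <oo) (k%:R * tail (psi q) k)%:E)%E &
      ((1 - tail (psi q') 0)%:E =
        \sum_(n <oo) (mass (psi q) n * (1 - p) ^+ n)%:E)%E].
Proof.
move=> p01.
have [d [T [P [B [X [Blaw Xlaw ind]]]]]] := thinning_realization (psi q) p01.
have [q' q'E] := psi_thin p01 Blaw Xlaw ind.
have {q'E}q'E A : psi q' A = P (thinned_sum B X @^-1` A) by rewrite -q'E.
have mS := measurable_thinned_sum B X.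
exists q'; split.
- apply: EFin_inj; rewrite EFinM -!mean_psi -(mean_thinned_sum p01 Blaw Xlaw ind).
  rewrite layer_cake1// mean_tail; apply: eq_eseriesr => k _.
  by rewrite -tailE q'E.
- move=> k; rewrite -lee_fin -!tailE q'E -Blaw; apply: le_measure.
  + by rewrite inE -[X in measurable X]setTI; exact: mS.
  + by rewrite inE -[X in measurable X]setTI; exact: measurable_funP.
  + by move=> w /= /leq_trans; apply; exact: thinned_sum_le.
- rewrite -(binomial_thinned_sum p01 Blaw Xlaw ind) layer_cake//.
  by apply: eq_eseriesr => k _; rewrite EFinM -tailE q'E.
- rewrite -(thinned_sum_eq0 p01 Blaw Xlaw ind) -mass0E -massE q'E.
  by congr (P _).
Qed.

Lemma tail_psi_le q q' k : tail q 0 <= tail q' 0 ->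
  tail (psi q) k <= tail (psi q') k.
Proof.
move=> qq'; have [q'0|q'0] := eqVneq (tail q' 0) 0.
  rewrite (@eq_psi q q')// q'0; apply/eqP; rewrite eq_le tail_ge0 andbT.
  by rewrite -q'0.
have q'p : 0 < tail q' 0 by rewrite lt_neqAle eq_sym q'0 tail_ge0.
have p01 : 0 <= tail q 0 / tail q' 0 <= 1.
  by rewrite divr_ge0 ?tail_ge0//= ler_pdivrMr// mul1r.
have [q2 [q2E H _ _]] := thinning_psi q' p01.
by rewrite (@eq_psi q q2)// q2E divfK.
Qed.

(** The law of load tail q 0 is a thinning, with a positive parameter p, of the law
of load tail q' 0, so that the two moments differ by the finite factor p^2. *)
Lemma psi_second_moment q q' C : 0 < tail q 0 -> tail q 0 <= tail q' 0 ->
  (forall n, \sum_(k < n) k%:R * tail (psi q) k <= C) ->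
  exists C', forall n, \sum_(k < n) k%:R * tail (psi q') k <= C'.
Proof.
move=> q0 qq' qC; have q'p : 0 < tail q' 0 by exact: lt_le_trans qq'.
pose p := tail q 0 / tail q' 0.
have p0 : 0 < p by rewrite divr_gt0.
have p01 : 0 <= p <= 1 by rewrite ltW//= ler_pdivrMr// mul1r.
have [q2 [q2E _ H _]] := thinning_psi q' p01.
rewrite (@eq_psi q2 q) in H; last by rewrite q2E divfK// gt_eqF.
have u0 q3 k : (0 <= (k%:R * tail (psi q3) k)%:E)%E.
  by rewrite lee_fin mulr_ge0// tail_ge0.
exists (p ^- 2 * C) => n; rewrite ler_pdivlMl ?exprn_gt0//.
rewrite -lee_fin EFinM -sumEFin.
apply: (@le_trans _ _ ((p ^+ 2)%:E * \sum_(k <oo) (k%:R * tail (psi q') k)%:E)%E).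
  apply: lee_wpmul2l; first by rewrite lee_fin exprn_ge0// ltW.
  rewrite -(big_mkord xpredT (fun k => (k%:R * tail (psi q') k)%:E)).
  by apply: nneseries_lim_ge => *; exact: u0.
rewrite -H; apply: lime_le; first by apply: is_cvg_nneseries => k _ _; exact: u0.
by apply: nearW => m; rewrite big_mkord sumEFin lee_fin.
Qed.

(** By thinning the law y of load 1, the law of load s has mass
sum_n y(n) (1 - s)^n at 0.  Any n0 with y(n0 + 1) > 0 gives the linear bound,
because x^(n0+1) - z^(n0+1) >= z^n0 (x - z) for x >= z >= 1 - r. *)
Lemma tail_psi_gap (r : R) : r < 1 -> exists2 kappa : R, 0 < kappa &
  forall q q', tail q 0 <= tail q' 0 -> tail q' 0 <= r ->
    kappa * (tail q' 0 - tail q 0) <= tail (psi q') 0 - tail (psi q) 0.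
Proof.
move=> r1; pose q1 : probability nat R := \d_1%N.
have q10 : tail q1 0 = 1 by rewrite /tail /q1 /dirac /= indicE mem_set.
have q1_cvg : series (tail (psi q1)) @ \oo --> (1 : R).
  by apply: mean_tail_cvg; rewrite mean_psi q10.
have [n0 mn0] : exists n, 0 < mass (psi q1) n.+1.
  apply/not_existsP => H.
  have tailC k : tail (psi q1) k = tail (psi q1) 0.
    elim: k => // k <-; apply/eqP; rewrite -subr_eq0 -opprB -massSE oppr_eq0.
    by rewrite eq_le mass_ge0 andbT leNgt; apply/negP/H.
  have t0 : tail (psi q1) 0 = 0.
    have tE : tail (psi q1) = cst (tail (psi q1) 0) by apply/funext.
    have : tail (psi q1) k @[k --> \oo] --> 0.
      by apply: cvg_series_cvg_0; apply/cvg_ex; exists 1.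
    by rewrite tE => /(cvg_lim (@Rhausdorff R)) <-; rewrite lim_cst.
  have /eqP : (1 : R) = 0; last by rewrite oner_eq0.
  rewrite -(cvg_lim _ q1_cvg)// (_ : series _ = cst 0) ?lim_cst//.
  by apply/funext => n; rewrite /series /= big1// => k _; rewrite tailC.
pose y n := mass (psi q1) n.
exists (y n0.+1 * (1 - r) ^+ n0); first by rewrite mulr_gt0// exprn_gt0// subr_gt0.
move=> q q' qq' q'r.
have H q2 : tail q2 0 <= r ->
    series (fun n => y n * (1 - tail q2 0) ^+ n) @ \oo --> (1 - tail (psi q2) 0).
  move=> q2r; have p01 : 0 <= tail q2 0 <= 1 by rewrite tail_ge0 tail_le1.
  have [q3 [q3E _ _ q3_0]] := thinning_psi q1 p01.
  rewrite q10 mulr1 in q3E; rewrite (@eq_psi q2 q3)//.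
  apply: nneseries_fin_cvg => [k|]; last exact/esym.
  by rewrite mulr_ge0 ?mass_ge0// exprn_ge0// subr_ge0 tail_le1.
pose u q2 n := y n * (1 - tail q2 0) ^+ n.
have Hdiff : series (u q) n - series (u q') n @[n --> \oo] -->
    tail (psi q') 0 - tail (psi q) 0.
  rewrite (_ : _ - _ = (1 - tail (psi q) 0) - (1 - tail (psi q') 0)); last by lra.
  by apply: cvgB; apply: H => //; exact: le_trans q'r.
rewrite -(cvg_lim _ Hdiff)//; apply: limr_ge.
  by apply/cvg_ex; eexists; exact: Hdiff.
near=> n.
have n0n : (n0.+1 < n)%N by near: n; exact: nbhs_infty_gt.
rewrite /series /= !big_mkord -sumrB (bigD1 (Ordinal n0n))//= -[leLHS]addr0.
have s0 : 0 <= 1 - tail q' 0 by rewrite subr_ge0 tail_le1.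
have ss : 1 - tail q' 0 <= 1 - tail q 0 by rewrite lerB.
have y0 k : 0 <= y k by exact: mass_ge0.
apply: lerD; last first.
  apply: sumr_ge0 => k _; rewrite /u -mulrBr mulr_ge0// subr_ge0.
  by apply: lerXn2r; rewrite ?nnegrE//; exact: le_trans ss.
rewrite /u -mulrBr -mulrA ler_wpM2l//.
set a := 1 - tail q 0; set b := 1 - tail q' 0.
have -> : tail q' 0 - tail q 0 = a - b by rewrite /a /b; lra.
apply: (@le_trans _ _ (b ^+ n0 * (a - b))).
  rewrite ler_wpM2r ?subr_ge0//; apply: lerXn2r; rewrite ?nnegrE//.
    by rewrite subr_ge0 ltW.
  by rewrite lerB.
have : b ^+ n0 <= a ^+ n0 by apply: lerXn2r; rewrite ?nnegrE//; exact: le_trans ss.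
rewrite !exprS => ab; have := ler_wpM2l (le_trans s0 ss) ab; rewrite -/a; lra.
Unshelve. all: by end_near. Qed.

End thinning_family.

(** * A summable majorant for the tails *)

Section abel.
Context (R : realType).
Implicit Types a : nat -> R.

Lemma sum_jump a n : \sum_(k < n.+1) jump a k = 1 - a n.
Proof.
elim: n => [|n IH]; first by rewrite big_ord1.
by rewrite big_ord_recr /= IH /jump; ring.
Qed.

Lemma sum_weighted_decrements a n :
  \sum_(k < n) k.+1%:R * (a k - a k.+1) = \sum_(k < n) a k - n%:R * a n.
Proof.
elim: n => [|n IH]; first by rewrite !big_ord0 mul0r subrr.
by rewrite !big_ord_recr /= IH -natr1; ring.
Qed.

Lemma sum_weighted_jump_le a n : (forall k, 0 <= a k) ->
  \sum_(k < n) k%:R * jump a k <= \sum_(k < n) a k.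
Proof.
move=> a0; case: n => [|n]; first by rewrite !big_ord0.
rewrite big_ord_recl mul0r add0r /=.
rewrite (eq_bigr (fun k : 'I_n => k.+1%:R * (a k - a k.+1)))//.
rewrite sum_weighted_decrements big_ord_recr /=.
by have := a0 n; have := ler0n R n; nra.
Qed.

End abel.

Section domination.
Context (R : realType) (m : nat -> R) (r : R).
Hypotheses (m1 : subprob m) (r01 : 0 <= r < 1)
  (m_mean : forall n, \sum_(k < n) k%:R * m k <= r).
Implicit Types g f : nat -> R.

(** The transport kernel with the mass at 0 killed: it describes a queue with
arrival law m until it first becomes empty. *)
Definition drain g k : R := \sum_(j < k.+1) m j * g (k - j).+1.

Lemma drain_ge0 g : (forall k, 0 <= g k) -> forall k, 0 <= drain g k.
Proof. by move=> g0 k; apply: sumr_ge0 => j _; rewrite mulr_ge0// m1.1. Qed.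

Lemma drain_le f g : (forall k, f k <= g k) -> forall k, drain f k <= drain g k.
Proof. by move=> fg k; apply: ler_sum => j _; rewrite ler_wpM2l// m1.1. Qed.

Lemma drain_sum (F : nat -> nat -> R) t k :
  drain (fun k => \sum_(i < t) F i k) k = \sum_(i < t) drain (F i) k.
Proof.
by rewrite /drain exchange_big /=; apply: eq_bigr => j _; rewrite mulr_sumr.
Qed.

(** The function i + 1 is superharmonic for the killed queue, with a drift of at
least 1 - r at every step. *)
Lemma drain_moment g n : (forall k, 0 <= g k) ->
  \sum_(k < n) k.+1%:R * drain g k + (1 - r) * \sum_(k < n) g k <=
  \sum_(k < n.+1) k.+1%:R * g k.
Proof.
move=> g0; case/andP: r01 => r0 r1; have [m0 mle1] := m1.
have -> : \sum_(k < n) k.+1%:R * drain g k =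
    \sum_(k < n) \sum_(j < k.+1) (j + (k - j)).+1%:R * (m j * g (k - j).+1).
  apply: eq_bigr => k _; rewrite mulr_sumr; apply: eq_bigr => j _.
  by rewrite subnKC// -ltnS.
rewrite (sum_triangle (fun j i => (j + i).+1%:R * (m j * g i.+1))).
have H1 : \sum_(j < n) \sum_(i < n - j) (j + i).+1%:R * (m j * g i.+1) <=
    \sum_(i < n) (i.+1%:R + r) * g i.+1.
  apply: (@le_trans _ _ (\sum_(j < n) \sum_(i < n) (j + i).+1%:R * (m j * g i.+1))).
    apply: ler_sum => j _.
    apply: (ler_sum_widen (g := fun i => (j + i).+1%:R * (m j * g i.+1))).
      by move=> i; rewrite !mulr_ge0.
    exact: leq_subr.
  rewrite exchange_big /=; apply: ler_sum => i _.
  have -> : \sum_(j < n) (j + i).+1%:R * (m j * g i.+1) =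
      (i.+1%:R * \sum_(j < n) m j + \sum_(j < n) j%:R * m j) * g i.+1.
    rewrite mulr_sumr -big_split /= mulr_suml; apply: eq_bigr => j _.
    by rewrite -addnS natrD; ring.
  by rewrite ler_wpM2r// lerD// ler_piMr.
have H2 : \sum_(k < n) g k <= g 0%N + \sum_(i < n) g i.+1.
  by rewrite -(big_ord_recl n (fun k : 'I_n.+1 => g k)); exact: ler_sum_widen.
rewrite big_ord_recl /= mul1r.
have -> : \sum_(i < n) (bump 0 i).+1%:R * g (bump 0 i) =
    \sum_(i < n) (i.+1%:R + r) * g i.+1 + (1 - r) * \sum_(i < n) g i.+1.
  rewrite mulr_sumr -big_split /=; apply: eq_bigr => i _.
  by rewrite /bump /= -[i.+2%:R]natr1; ring.
have : (1 - r) * \sum_(k < n) g k <= (1 - r) * (g 0%N + \sum_(i < n) g i.+1).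
  by rewrite ler_wpM2l// subr_ge0 ltW.
have := mulr_ge0 r0 (g0 0%N); lra.
Qed.

(** Summing the drift inequality along the iterates bounds the total occupation by
the initial first moment.  Each step looks one unit further, whence the range
n + t on the right. *)
Lemma drain_potential f t n : (forall k, 0 <= f k) ->
  (1 - r) * \sum_(i < t) \sum_(k < n) iter i drain f k <=
  \sum_(k < n + t) k.+1%:R * f k.
Proof.
case/andP: r01 => r0 r1.
elim: t f => [|t IH] f f0.
  by rewrite big_ord0 mulr0; apply: sumr_ge0 => k _; rewrite mulr_ge0.
rewrite big_ord_recl /= mulrDr addnS; apply: le_trans (drain_moment _ f0).
rewrite addrC lerD//.
  apply: le_trans (IH _ (drain_ge0 f0)); rewrite ler_wpM2l ?subr_ge0 ?(ltW r1)//.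
  by apply: ler_sum => i _; rewrite /bump /= -iterSr.
rewrite ler_wpM2l ?subr_ge0 ?(ltW r1)//.
by apply: ler_sum_widen => //; exact: leq_addr.
Qed.

(** The majorant c is the potential of f, the sum of all iterates of drain on f; it
satisfies c = f + drain c, so that sequences with a(t+1) <= f + drain a(t) stay
below it. *)
Lemma drain_dominated f (W : R) : (forall k, 0 <= f k) ->
  (forall n, \sum_(k < n) k.+1%:R * f k <= W) ->
  exists c : nat -> R, [/\ forall k, 0 <= c k, cvgn (series c) &
    forall a : nat -> nat -> R, (forall k, a 0%N k <= f k) ->
      (forall t k, a t.+1 k <= f k + drain (a t) k) -> forall t k, a t k <= c k].
Proof.
move=> f0 fW; case/andP: r01 => r0 r1.
pose C t k := \sum_(i < t) iter i drain f k.
have i0 i k : 0 <= iter i drain f k.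
  by elim: i k => // i IH k; exact: drain_ge0.
have Cnd k : nondecreasing_seq (C ^~ k).
  by move=> s t st; apply: (ler_sum_widen (g := fun i => iter i drain f k)).
have Csum t n : \sum_(k < n) C t k <= W / (1 - r).
  rewrite ler_pdivlMr ?subr_gt0// mulrC exchange_big /=.
  exact: le_trans (drain_potential _ _ f0) (fW _).
have C0 t k : 0 <= C t k by apply: sumr_ge0.
have Cbd t k : C t k <= W / (1 - r).
  apply: le_trans (Csum t k.+1); rewrite big_ord_recr /= lerDr.
  by apply: sumr_ge0.
have Ccv k : cvgn (C ^~ k).
  by apply: nondecreasing_is_cvgn => //; exists (W / (1 - r)) => _ [t _ <-].
exists (fun k => limn (C ^~ k)); split.
- by move=> k; apply: limr_ge => //; apply: nearW.
- apply: (@bounded_series_cvg _ _ (W / (1 - r))) => [k|n].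
    by apply: limr_ge => //; apply: nearW.
  have H : (\sum_(k < n) C t k) @[t --> \oo] --> \sum_(k < n) limn (C ^~ k).
    by apply: cvg_big => [|k _]; [exact: add_continuous|exact: Ccv].
  rewrite -(cvg_lim _ H)//; apply: limr_le; first by apply/cvg_ex; eexists; exact: H.
  by apply: nearW => t; exact: Csum.
move=> a a0 aS t k; apply: le_trans (nondecreasing_cvgn_le (Cnd k) (Ccv k) t.+1).
elim: t k => [|t IH] k; first by rewrite /C big_ord1.
rewrite /C big_ord_recl /=; apply: le_trans (aS t k) _; rewrite lerD2l.
by apply: le_trans (drain_le IH k) _; rewrite drain_sum.
Qed.

End domination.

(** * From tails to weak convergence *)

Section weak_convergence.
Context (R : realType).
Implicit Types (p q : probability nat R) (h : nat -> R).

Lemma bounded_integral p h (M : R) : (forall n, 0 <= h n <= M) ->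
  exists2 e : R, (\int[p]_n (h n)%:E = e%:E)%E &
    series (fun n => h n * mass p n) @ \oo --> e.
Proof.
move=> hM.
have h0 n : 0 <= h n by case/andP: (hM n).
have fin : (\int[p]_n (h n)%:E \is a fin_num)%E.
  rewrite ge0_fin_numE; last by apply: integral_ge0 => n _; rewrite lee_fin.
  apply: (@le_lt_trans _ _ (\int[p]_n (cst M%:E) n)%E); last first.
    by rewrite integral_cst//= probability_setT mule1 ltry.
  apply: ge0_le_integral => //.
  - by move=> n _; rewrite lee_fin.
  - by move=> n _; rewrite lee_fin; case/andP: (hM n).
exists (fine (\int[p]_n (h n)%:E)%E); first by rewrite fineK.
apply: nneseries_fin_cvg => [n|]; first by rewrite mulr_ge0 ?mass_ge0.
rewrite fineK// integral_natE => [|n]; last by rewrite lee_fin.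
by apply: eq_eseriesr => n _; rewrite massE EFinM.
Qed.

Lemma mass_dist_le p q n :
  \sum_(k < n) `|mass p k - mass q k| <=
  2 * \sum_(k < n) `|tail p k - tail q k|.
Proof.
case: n => [|n]; first by rewrite !big_ord0 mulr0.
suff : \sum_(k < n.+1) `|mass p k - mass q k| <=
    2 * \sum_(k < n.+1) `|tail p k - tail q k| - `|tail p n - tail q n|.
  by have := normr_ge0 (tail p n - tail q n); lra.
elim: n => [|n IH].
  rewrite !big_ord1 !mass0E (_ : _ - _ = - (tail p 0 - tail q 0)); last by ring.
  by rewrite normrN; lra.
rewrite 2!(big_ord_recr n.+1) /= !massSE.
rewrite (_ : _ - _ - _ = (tail p n - tail q n) - (tail p n.+1 - tail q n.+1));
  last by ring.
have := ler_normB (tail p n - tail q n) (tail p n.+1 - tail q n.+1); lra.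
Qed.

Lemma integral_dist_le p q h (M d e e' : R) : (forall n, 0 <= h n <= M) ->
  (forall n, \sum_(k < n) `|tail p k - tail q k| <= d) ->
  (\int[p]_n (h n)%:E = e%:E)%E -> (\int[q]_n (h n)%:E = e'%:E)%E ->
  `|e - e'| <= M * (2 * d).
Proof.
move=> hM pq.
have [i -> cp] := bounded_integral p hM; move=> [<-].
have [j -> cq] := bounded_integral q hM; move=> [<-].
have H : `|series (fun n => h n * mass p n) n - series (fun n => h n * mass q n) n|
    @[n --> \oo] --> `|i - j|.
  by apply: cvg_norm; apply: cvgB.
rewrite -(cvg_lim _ H)//; apply: limr_le; first by apply/cvg_ex; eexists; exact: H.
apply: nearW => n; rewrite /series /= !big_mkord -sumrB.
apply: le_trans (ler_norm_sum _ _ _) _.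
have M0 : 0 <= M by case/andP: (hM 0%N) => /le_trans; apply.
apply: (@le_trans _ _ (M * \sum_(k < n) `|mass p k - mass q k|)).
  rewrite mulr_sumr; apply: ler_sum => k _; rewrite -mulrBr normrM ler_wpM2r//.
  by case/andP: (hM k) => h0 ?; rewrite ger0_norm.
rewrite ler_wpM2l//; apply: le_trans (mass_dist_le _ _ _) _.
by rewrite ler_wpM2l.
Qed.

Lemma tail_l1_weakly_converges (mu : nat -> probability nat R) nu :
  (forall t, cvgn (series (fun k => `|tail (mu t) k - tail nu k|))) ->
  limn (series (fun k => `|tail (mu t) k - tail nu k|)) @[t --> \oo] --> 0 ->
  weakly_converges mu nu.
Proof.
move=> cv l10 f _ /pinfty_ex_gt0[M M0 fM].
have {}fM n : `|f n| <= M by exact: fM.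
pose fp n := Num.max (f n) 0; pose fn n := Num.max (- f n) 0.
have fpM n : 0 <= fp n <= M.
  by rewrite le_max lexx orbT /= ge_max (ltW M0) andbT (le_trans (ler_norm _)).
have fnM n : 0 <= fn n <= M.
  rewrite le_max lexx orbT /= ge_max (ltW M0) andbT (le_trans (ler_norm _))//.
  by rewrite normrN.
pose E (p : probability nat R) : R :=
  fine (\int[p]_n (fp n)%:E)%E - fine (\int[p]_n (fn n)%:E)%E.
have EE p : ('E_p[f] = (E p)%:E)%E.
  rewrite unlock integralE.
  have [e ee _] := bounded_integral p fpM.
  have [e' ee' _] := bounded_integral p fnM.
  rewrite /E EFinB !fineK ?ee ?ee'//; congr (_ - _)%E.
    by rewrite -ee; apply: eq_integral => n _; rewrite funeposE /fp EFin_max.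
  by rewrite -ee'; apply: eq_integral => n _; rewrite funenegE /fn EFin_max EFinN.
under eq_cvg do rewrite EE.
rewrite EE; apply: cvg_EFin; first exact: nearW.
apply/cvgrPdist_le => eps eps0.
pose delta := eps / (4 * M + 1).
have M1 : 0 < 4 * M + 1 by lra.
have d0 : 0 < delta by rewrite divr_gt0.
move/cvgrPdist_le/(_ _ d0) : l10; apply: filterS => t /=.
rewrite sub0r normrN => /(le_trans (ler_norm _)) ltd.
have ptd n : \sum_(k < n) `|tail (mu t) k - tail nu k| <= delta.
  by apply: le_trans ltd; exact: sum_le_lim.
have [e ee _] := bounded_integral (mu t) fpM.
have [e' ee' _] := bounded_integral (mu t) fnM.
have [i ii _] := bounded_integral nu fpM.
have [i' ii' _] := bounded_integral nu fnM.
have H1 := integral_dist_le fpM ptd ee ii.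
have H2 := integral_dist_le fnM ptd ee' ii'.
rewrite /comp /E ee ee' ii ii' /=.
have -> : i - i' - (e - e') = (e' - i') - (e - i) by ring.
apply: le_trans (ler_normB _ _) _.
have : delta * (4 * M + 1) = eps by rewrite /delta divfK// gt_eqF.
nra.
Qed.

End weak_convergence.

(** * The difference of two solutions *)

Section transport_step.
Context (R : realType) (psi : probability nat R -> probability nat R).
Hypotheses (psi_mean : mean_condition psi) (psi_thin : thinning_condition psi).
Context (r kappa : R).
Hypothesis r1 : r < 1.
Hypothesis kappa0 : 0 < kappa.
Hypothesis gap : forall q q', tail q 0 <= tail q' 0 -> tail q' 0 <= r ->
    kappa * (tail q' 0 - tail q 0) <= tail (psi q') 0 - tail (psi q) 0.

Lemma subprob_jump (a : nat -> R) : (forall k, 0 <= a k) -> a 0%N <= 1 ->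
  (forall k, a k.+1 <= a k) -> subprob (jump a).
Proof.
move=> a0 a1 an; split=> [[|k]|[|n]]; rewrite ?subr_ge0 ?big_ord0//.
by rewrite sum_jump gerBl.
Qed.

Lemma subprob_jump_tail (p : probability nat R) : subprob (jump (tail p)).
Proof.
apply: subprob_jump => [k||k]; [exact: tail_ge0|exact: tail_le1|].
exact: tail_le.
Qed.

Lemma sum_tail_le_mean (p : probability nat R) (s : R) n :
  mean p = s%:E -> \sum_(k < n) tail p k <= s.
Proof.
move=> /mean_tail_cvg pr; rewrite -(cvg_lim _ pr)//; apply: sum_le_lim.
  by move=> k; exact: tail_ge0.
by apply/cvg_ex; exists s.
Qed.

(** Split the difference of the two images as a change of the queue length under
the arrivals of p, which moves mass as transport does, plus a change of the
arrivals at fixed queue length pi.  By stochastic monotonicity the latter has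
the sign of the difference of the loads, which is the mass at 0; divided by this
mass it is a subprobability rho, since arrival laws differ in mean by exactly
the difference of the loads.  When the loads agree the arrivals agree, and the
point mass at 0 serves as rho. *)
Lemma queue_step_transport (p p' pi : probability nat R) :
  queue_step (psi p) p p' -> queue_step (psi pi) pi pi ->
  tail p 0 <= r -> tail pi 0 <= r ->
  exists rho, [/\ subprob rho, Num.min 1 (kappa * (1 - r)) <= rho 0%N &
    forall k, tail p' k - tail pi k =
      transport (jump (tail (psi p))) rho (fun i => tail p i - tail pi i) k].
Proof.
move=> stp sti pr ir.
pose y := jump (fun i => tail pi i.+1).
have ysub : subprob y.
  by apply: subprob_jump => [k||k]; [exact: tail_ge0|exact: tail_le1|exact: tail_le].
have stepE k : tail p' k - tail pi k =
    \sum_(j < k.+1) jump (tail (psi p)) j * (tail p (k - j).+1 - tail pi (k - j).+1) +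
    \sum_(i < k.+1) y i * (tail (psi p) (k - i)%N - tail (psi pi) (k - i)%N).
  rewrite (queue_step_tail stp) (queue_step_tail sti).
  under eq_bigr do rewrite mulrBr; rewrite sumrB.
  under [X in _ = _ + X]eq_bigr do rewrite mulrBr; rewrite sumrB.
  rewrite conv_tailC {2}/conv_tail {1}/conv_tail -/y.
  have := conv_tailC (fun i => tail pi i.+1) (tail (psi p)) k.
  rewrite /conv_tail -/y; lra.
have [ps|ps] := eqVneq (tail p 0) (tail pi 0).
  exists (fun k => (k == 0%N)%:R); split.
  - split=> // -[|n]; first by rewrite big_ord0.
    by rewrite big_ord_recl /= big1 ?addr0.
  - by rewrite ge_min lexx.
  - move=> k; rewrite stepE /transport ps subrr mul0r; congr (_ + _).
    by rewrite big1// => i _; rewrite (eq_psi psi_mean ps) subrr mulr0.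
pose D0 := tail p 0 - tail pi 0.
have D0n : D0 != 0 by rewrite subr_eq0.
pose e k := (tail (psi p) k - tail (psi pi) k) / D0.
have e0 k : 0 <= e k.
  rewrite /e; have [pp|pp] := leP (tail p 0) (tail pi 0).
    rewrite -[leRHS]mulrNN -invrN mulr_ge0 ?invr_ge0 ?oppr_ge0 ?subr_le0//.
    exact: tail_psi_le.
  rewrite mulr_ge0 ?invr_ge0 ?subr_ge0//; last exact: ltW.
  by apply: tail_psi_le => //; exact: ltW.
have esum n : \sum_(k < n) e k <= 1.
  have H : (series (tail (psi p)) n - series (tail (psi pi)) n) / D0
      @[n --> \oo] --> D0 / D0.
    by apply: cvgMl; apply: cvgB; apply: mean_tail_cvg; exact: mean_psi.
  have Hs : series e @ \oo --> D0 / D0.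
    apply: cvg_trans H; apply: near_eq_cvg; apply: nearW => m.
    by rewrite /series /= -sumrB mulr_suml.
  rewrite divff// in Hs; rewrite -(cvg_lim _ Hs)//; apply: sum_le_lim => //.
  by apply/cvg_ex; exists 1.
exists (fun k => \sum_(i < k.+1) y i * e (k - i)%N); split.
- split=> [k|n]; first by apply: sumr_ge0 => i _; rewrite mulr_ge0// ysub.1.
  apply: le_trans (sum_conv_le n ysub.1 e0) _.
  apply: mulr_ile1 => //; [|exact: sumr_ge0|exact: ysub.2].
  by apply: sumr_ge0 => i _; exact: ysub.1.
- rewrite big_ord1 subn0 ge_min; apply/orP; right.
  have y0 : 1 - r <= y 0%N.
    by rewrite /y /jump lerB// (le_trans _ ir)//; exact: tail_le.
  have ek : kappa <= e 0%N.
    rewrite /e; have [pp|pp] := leP (tail p 0) (tail pi 0).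
      rewrite -[leRHS]mulrNN -invrN.
      rewrite ler_pdivlMr ?oppr_gt0 ?subr_lt0 ?lt_neqAle ?ps//.
      by rewrite !opprB; exact: gap.
    by rewrite ler_pdivlMr ?subr_gt0//; apply: gap => //; exact: ltW.
  by rewrite mulrC; apply: ler_pM => //; rewrite ?subr_ge0 ltW.
- move=> k; rewrite stepE /transport; congr (_ + _).
  rewrite mulr_sumr; apply: eq_bigr => i _; rewrite mulrCA; congr (_ * _).
  by rewrite /e mulrC divfK.
Qed.

End transport_step.

(** * Second moments and convergence *)

Section stationary.
Context (R : realType).

(** In the stationary tail equation keep only the term where the queue is empty
after a departure: tail p k - tail p (k+1) is at least (1 - tail p 1) times
tail mu k.  Summing with weights k + 1 telescopes to the mean of p. *)
Lemma stationary_moment (mu p : probability nat R) (r : R) :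
  queue_step mu p p -> mean p = r%:E -> tail p 0 < 1 ->
  exists C, forall n, \sum_(k < n) k%:R * tail mu k <= C.
Proof.
move=> stp pr p1; have y0 : 0 < 1 - tail p 1.
  by rewrite subr_gt0; apply: le_lt_trans p1; exact: tail_le.
exists (r / (1 - tail p 1)) => n; rewrite ler_pdivlMr// mulr_suml.
apply: (@le_trans _ _ (\sum_(k < n) k.+1%:R * (tail p k - tail p k.+1))).
  apply: ler_sum => k _; rewrite -mulrA.
  apply: (@le_trans _ _ (k.+1%:R * (tail mu k * (1 - tail p 1)))).
    by rewrite ler_wpM2r ?ler_nat// mulr_ge0 ?tail_ge0// ltW.
  rewrite ler_wpM2l// (queue_step_tail stp k) /conv_tail addrAC subrr add0r.
  rewrite big_ord_recl /= subn0 mulrC lerDl; apply: sumr_ge0 => i _.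
  by rewrite mulr_ge0 ?tail_ge0// subr_ge0 tail_le.
rewrite sum_weighted_decrements; apply: le_trans (sum_tail_le_mean n pr).
by rewrite gerBl mulr_ge0// tail_ge0.
Qed.

(** The sum of k + 1 over k < n is at most n^2, and (lambda n / 2)^2 <=
exp (lambda n). *)
Lemma exponential_moment_tail d (Omega : measurableType d) (P : probability Omega R)
    (X : {RV P >-> nat}) (lambda : R) : 0 < lambda ->
  ('E_P[fun w => expR (lambda * (X w)%:R)%R] < +oo)%E ->
  exists W, forall n, \sum_(k < n) k.+1%:R * tail (distribution P X) k <= W.
Proof.
move=> l0; rewrite unlock => Efin.
have mX : measurable_fun setT X by exact: measurable_funP.
pose h n : R := expR (lambda * n%:R).
have Ege : (0 <= \int[P]_w (h (X w))%:E)%E.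
  by apply: integral_ge0 => w _; rewrite lee_fin expR_ge0.
exists (4 / lambda ^+ 2 * fine (\int[P]_w (h (X w))%:E)%E) => n.
rewrite -lee_fin EFinM fineK; last by rewrite ge0_fin_numE.
have mh : measurable_fun setT (fun w => (h (X w))%:E).
  by apply/measurable_EFinP; apply: (measurableT_comp (f := h)).
apply: (@le_trans _ _ (\int[P]_w (\sum_(k < X w) k.+1%:R)%:E)%E).
  rewrite (layer_cake P (w := fun k => k.+1%:R) mX)// -sumEFin.
  rewrite -(big_mkord xpredT (fun k => (k.+1%:R * tail (distribution P X) k)%:E)).
  rewrite (eq_bigr (fun k => (k.+1%:R%:E * P [set x | (k < X x)%N])%E)).
    by apply: nneseries_lim_ge => *; rewrite mule_ge0// lee_fin.
  by move=> k _; rewrite EFinM -tailE.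
rewrite -ge0_integralZl//; last 2 first.
- by move=> w _; rewrite lee_fin expR_ge0.
- by rewrite lee_fin divr_ge0// exprn_ge0// ltW.
apply: ge0_le_integral => //.
- by move=> w _; rewrite lee_fin sumr_ge0.
- apply/measurable_EFinP.
  by apply: (measurableT_comp (f := fun n : nat => \sum_(k < n) k.+1%:R : R)).
- by apply: emeasurable_funM.
move=> w _; rewrite -EFinM lee_fin; move: (X w) => {}n.
rewrite mulrAC ler_pdivlMr ?exprn_gt0//.
apply: (@le_trans _ _ (n%:R * n%:R * lambda ^+ 2)).
  apply: ler_wpM2r; first by rewrite exprn_ge0// ltW.
  apply: (@le_trans _ _ (\sum_(k < n) n%:R)).
    by apply: ler_sum => k _; rewrite ler_nat.
  by rewrite sumr_const card_ord mulr_natl.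
rewrite /h (_ : lambda * n%:R = lambda * n%:R / 2 + lambda * n%:R / 2); last by lra.
rewrite expRD; set x := _ / 2.
have x0 : 0 <= x by rewrite /x divr_ge0// mulr_ge0// ltW.
have -> : n%:R * n%:R * lambda ^+ 2 = 4 * (x * x) by rewrite /x; field.
have : x <= expR x by apply: le_trans (expR_ge1Dx x); rewrite lerDr.
by move=> xe; rewrite ler_wpM2l//; apply: ler_pM.
Qed.

End stationary.

Theorem theorem4p9 (R : realType) (psi : probability nat R -> probability nat R)
  (d : measure_display) (Omega : measurableType d) (P : probability Omega R)
  (eta B : nat -> {RV P >-> nat}) (r : R) (pibar : probability nat R) :
  tv_measurable psi ->
  nonlinear_process psi eta B ->
  0 <= r < 1 ->
  ('E_P[fun w => (eta 0%N w)%:R] = r%:E)%E ->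
  (exists2 lambda : R, 0 < lambda &
     ('E_P[fun w => expR (lambda * (eta 0%N w)%:R)%R] < +oo)%E) ->
  mean_condition psi ->
  thinning_condition psi ->
  unique (fun pi => queue_invariant_laws psi pi /\ mean pi = r%:E) pibar ->
  weakly_converges (fun t => distribution P (eta t)) pibar.
Proof.
move=> _ proc r01 mean0 [lambda lambda0 exp0] psi_mean psi_thin.
move=> [[[q [_ inv]] pibar_mean] _].
have [r0 r1] := andP r01.
have stepq : queue_step (psi q) pibar pibar by move=> A; rewrite inv.
(* The conserved mean forces the load of pibar to be the mean of its arrivals. *)
have pibar_q : tail pibar 0 = tail q 0.
  have := queue_step_mean stepq.
  by rewrite pibar_mean mean_psi// -!EFinD => -[]; lra.
have step_pi : queue_step (psi pibar) pibar pibar.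
  by rewrite (eq_psi psi_mean pibar_q).
pose law t : probability nat R := distribution P (eta t).
have step t : queue_step (psi (law t)) (law t) (law t.+1).
  exact: process_queue_step proc t.
have law_mean t : mean (law t) = r%:E.
  elim: t => [|t IH].
    by rewrite -mean0 meanE ge0_integral_distribution// unlock.
  have := queue_step_mean (step t); rewrite IH mean_psi//.
  move=> /(congr1 (fun x => x - (tail (law t) 0)%:E)%E) /=.
  by rewrite addeK// -!EFinD addrK.
have tail0_le p : mean p = r%:E -> tail p 0 <= r.
  by move=> /(sum_tail_le_mean 1); rewrite big_ord1.
have pi_r := tail0_le _ pibar_mean.
have law_r t := tail0_le _ (law_mean t).
(* A law qr of load r, whose arrivals dominate those of the process. *)
pose q1 : probability nat R := \d_1%N.
have [qr qr0] : exists qr, tail qr 0 = r * tail q1 0.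
  have r01' : 0 <= r <= 1 by rewrite r0 ltW.
  by have [qr [? _ _ _]] := thinning_psi psi_mean psi_thin q1 r01'; exists qr.
have {}qr0 : tail qr 0 = r.
  by rewrite qr0 /tail /q1 /dirac /= indicE mem_set ?mulr1.
have [Cpi HCpi] := stationary_moment step_pi pibar_mean (le_lt_trans pi_r r1).
have [C HC] : exists C, forall n, \sum_(k < n) k%:R * tail (psi qr) k <= C.
  have [pi0|pi0] := eqVneq (tail pibar 0) 0; last first.
    apply: (psi_second_moment psi_mean psi_thin _ _ HCpi); rewrite ?qr0//.
    by rewrite lt_neqAle eq_sym pi0 tail_ge0.
  (* At load 0 the tail of pibar vanishes, so r = 0 and qr has the same load. *)
  exists Cpi => n; rewrite (@eq_psi _ _ psi_mean qr pibar)// pi0 qr0.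
  have tail0 k : tail pibar k = 0.
    by apply/eqP; rewrite eq_le tail_ge0 andbT -pi0; exact: tail_le.
  have := mean_tail_cvg pibar_mean.
  rewrite (_ : series _ = cst 0) => [/(cvg_lim (@Rhausdorff R)) <-|].
    by rewrite lim_cst.
  by apply/funext => n'; rewrite /series /= big1// => k _; rewrite tail0.
have [W HW] := exponential_moment_tail lambda0 exp0.
pose f k := tail (law 0) k + tail (psi qr) k.
have fW n : \sum_(k < n) k.+1%:R * f k <= W + (C + r).
  rewrite (eq_bigr (fun k : 'I_n => k.+1%:R * tail (law 0) k +
     (k%:R * tail (psi qr) k + tail (psi qr) k))) => [|k _]; last first.
    by rewrite /f -natr1; ring.
  rewrite !big_split /=; apply: lerD; first exact: HW.
  apply: lerD; first exact: HC.
  by apply: sum_tail_le_mean; rewrite mean_psi// qr0.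
have f0 k : 0 <= f k by rewrite addr_ge0 ?tail_ge0.
have jump_mean n : \sum_(k < n) k%:R * jump (tail (psi qr)) k <= r.
  apply: le_trans (sum_weighted_jump_le n (tail_ge0 _)) _.
  by apply: sum_tail_le_mean; rewrite mean_psi// qr0.
have [c [c0 c_cvg Hc]] := drain_dominated (subprob_jump_tail _) r01 jump_mean f0 fW.
have law_c t k : tail (law t) k <= c k.
  apply: (Hc (fun t => tail (law t))) => [{}k|{}t {}k].
    by rewrite lerDl tail_ge0.
  rewrite (queue_step_tail (step t)).
  apply: (@le_trans _ _
    (conv_tail (fun i => tail (law t) i.+1) (tail (psi qr)) k)).
    rewrite lerD2l; apply: ler_sum => i _; rewrite ler_wpM2l//.
      by case: i => -[|i] ? /=; rewrite subr_ge0 ?tail_le1// tail_le.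
    by apply: tail_psi_le => //; rewrite qr0.
  rewrite conv_tailC /conv_tail lerD2r lerDr; exact: tail_ge0.
have [kappa kappa0 gap] := tail_psi_gap psi_mean psi_thin r1.
have /choice[rho Hrho] : forall t, exists rho, [/\ subprob rho,
    Num.min 1 (kappa * (1 - r)) <= rho 0%N &
    forall k, tail (law t.+1) k - tail pibar k =
      transport (jump (tail (psi (law t)))) rho
       (fun i => tail (law t) i - tail pibar i) k].
  by move=> t; apply: queue_step_transport (step t) step_pi _ _.
pose D t k := tail (law t) k - tail pibar k.
pose delta := Num.min (1 - r) (Num.min 1 (kappa * (1 - r))).
have pi_cvg : cvgn (series (tail pibar)).
  by apply/cvg_ex; exists r; exact: mean_tail_cvg.
have Dc t k : `|D t k| <= (c + tail pibar) k.
  apply: le_trans (ler_normB _ _) _; rewrite !ger0_norm ?tail_ge0//.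
  by rewrite lerD2r.
have c_pi_cvg : cvgn (series (c + tail pibar)).
  by rewrite seriesD; exact: is_cvgD.
apply: tail_l1_weakly_converges => [t|].
  apply: (series_le_cvg _ _ (Dc t) c_pi_cvg) => // k.
  by rewrite addr_ge0 ?tail_ge0.
apply: (@transport_contraction _ (fun t => jump (tail (psi (law t)))) rho delta
   _ _ _ _ _ D (c + tail pibar)) => //.
- by move=> t; exact: subprob_jump_tail.
- by move=> t; have [] := Hrho t.
- by rewrite !lt_min subr_gt0 r1 ltr01 mulr_gt0// subr_gt0.
- move=> t; rewrite ge_min lerB//.
  apply: le_trans (law_r t).
  by have := sum_tail_le_mean 1 (mean_psi psi_mean (law t)); rewrite big_ord1.
- move=> t; rewrite ge_min; apply/orP; right; by have [] := Hrho t.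
- by move=> t k; have [_ _ rhoE] := Hrho t; exact: rhoE.
- move=> t.
  rewrite (_ : series (D t) =
    (fun n => series (tail (law t)) n - series (tail pibar) n)).
    by rewrite -(subrr r); apply: cvgB; apply: mean_tail_cvg.
  by apply/funext => n; rewrite /series /= -sumrB.
Qed.
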